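(* Let $\alpha>0$, $T_0>0$, and let $u$ be a smooth solution of the equivariant Skyrme equation \[ \Big(1+\tfrac{\alpha^2\sin^2u}{r^2}\Big)(u_{tt}-u_{rr}) - \Big(1-\tfrac{\alpha^2\sin^2u}{r^2}\Big)\tfrac{u_r}{r} + \tfrac{\sin 2u}{2r^2}\big[\alpha^2(u_t^2-u_r^2)+1\big]=0 \] in $\Omega=\{(t,r):0<t\le T_0,\ 0\le r\le t\}$ (for $r>0$), with $u(t,0)=0$. Then the energy does not concentrate at the origin: \[ \lim_{T\to0^+}\int_0^T\Big[\Big(1+\tfrac{\alpha^2\sin^2u(T,r)}{r^2}\Big)\tfrac{u_t(T,r)^2+u_r(T,r)^2}{2}+\tfrac{\sin^2u(T,r)}{2r^2}\Big]\,r\,dr=0. \]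
   Context: $u=u(t,r)$ is the longitudinal angle of a co-rotational (index 1) equivariant map $U(t,r,\omega)=(u(t,r),\omega)$ from $\mathbb{R}^{2+1}$ to $\mathbb{S}^2$, where $(r,\omega)$ are polar coordinates on $\mathbb{R}^2$; ''smooth solution in $\Omega$'' means $u$ is smooth on $\Omega$, satisfies the equation for $r>0$, and $u(t,0)=0$. *)

(* Defs.v *)
From Stdlib Require Import Reals.
Open Scope R_scope.

Definition open2 (U : R -> R -> Prop) : Prop :=
  forall t r, U t r -> exists d, 0 < d /\
    forall t' r', Rabs (t' - t) < d -> Rabs (r' - r) < d -> U t' r'.

Definition cont2_at (f : R -> R -> R) (t r : R) : Prop :=
  forall eps, 0 < eps -> exists d, 0 < d /\
    forall t' r', Rabs (t' - t) < d -> Rabs (r' - r) < d ->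
      Rabs (f t' r' - f t r) < eps.

(* D i j = partial derivative d^i/dt^i d^j/dr^j of D 0 0, all of them
   existing and jointly continuous on U: i.e. D 0 0 is C^infinity on U
   and D is its family of partial derivatives. *)
Definition smooth_family (U : R -> R -> Prop) (D : nat -> nat -> R -> R -> R)
  : Prop :=
  forall i j t r, U t r ->
    derivable_pt_lim (fun s => D i j s r) t (D (S i) j t r) /\
    derivable_pt_lim (fun s => D i j t s) r (D i (S j) t r) /\
    cont2_at (D i j) t r.

Definition Omega (T0 t r : R) : Prop := 0 < t <= T0 /\ 0 <= r <= t.

Definition smooth_on_Omega (T0 : R) (u : R -> R -> R)
  (D : nat -> nat -> R -> R -> R) : Prop :=
  exists U : R -> R -> Prop, open2 U /\
    (forall t r, Omega T0 t r -> U t r) /\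
    smooth_family U D /\
    (forall t r, U t r -> D 0%nat 0%nat t r = u t r).

Definition skyrme_eq (alpha : R) (D : nat -> nat -> R -> R -> R) (t r : R)
  : Prop :=
  let u := D 0%nat 0%nat t r in
  let ut := D 1%nat 0%nat t r in
  let ur := D 0%nat 1%nat t r in
  let utt := D 2%nat 0%nat t r in
  let urr := D 0%nat 2%nat t r in
  (1 + alpha ^ 2 * sin u ^ 2 / r ^ 2) * (utt - urr)
  - (1 - alpha ^ 2 * sin u ^ 2 / r ^ 2) * (ur / r)
  + sin (2 * u) / (2 * r ^ 2) * (alpha ^ 2 * (ut ^ 2 - ur ^ 2) + 1) = 0.

Definition energy_density (alpha : R) (D : nat -> nat -> R -> R -> R)
  (T r : R) : R :=
  let u := D 0%nat 0%nat T r in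
  let ut := D 1%nat 0%nat T r in
  let ur := D 0%nat 1%nat T r in
  ((1 + alpha ^ 2 * sin u ^ 2 / r ^ 2) * ((ut ^ 2 + ur ^ 2) / 2)
   + sin u ^ 2 / (2 * r ^ 2)) * r.

(* Main.v *)
(** Let [F = 1 + alpha^2 sin^2 u / r^2] and let [energy t] be the energy of the slice
    of the cone at time [t]. Since [u] vanishes on the axis, [slope = sin u / r] extends
    to a [C^1] function across it, so the balance laws can be integrated over whole
    slices. The energy identity makes [energy] nondecreasing, its derivative being the
    flux through [r = t]; hence [energy] has a limit as [t -> 0].

    The quartic term of the energy bounds [sin u u_r], the derivative of [1 - cos u],
    so [1 - cos u <= tip_rate * r] uniformly: [u] is small near the tip and
    [sin^2 u / r] is bounded.

    In the exterior region [lam T <= r <= T] the energy tends to [0]: in null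
    coordinates the two quantities [r F (u_t +- u_r)^2 / 2] satisfy a coupled transport
    system with coefficients [O(1/r)], and a weight that is monotone in both null
    directions absorbs the coupling and propagates smallness from the cone and from a
    fixed later time.

    In the interior, the multiplier [-9 r u_r - 4 sin u / F + sin u] yields a density
    [morawetz] whose integral over the slice at time [t] is [o(t)] and whose source
    dominates twice the energy density up to lower order terms. Integrating over
    [[T, 2 T]] gives [2 T energy(T) = o(T)]. *)

Require Import Defs.
From Stdlib Require Import Reals Lra Classical.
From Coquelicot Require Import Coquelicot.
Open Scope R_scope.

(** * Compact segments and open sets of the plane *)

Lemma filter_forall_segment {T : Type} (F : (T -> Prop) -> Prop) {FF : Filter F}
  (P : T -> R -> Prop) (a b : R) :
  (forall s, a <= s <= b ->
     filter_prod F (locally s) (fun p => P (fst p) (snd p))) ->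
  F (fun x => forall s, a <= s <= b -> P x s).
Proof.
  intros Hloc.
  destruct (Rlt_dec b a) as [Hba | Hab].
  { apply filter_forall. intros x s Hs. lra. }
  set (reached := fun c => a <= c <= b /\ F (fun x => forall s, a <= s <= c -> P x s)).
  assert (Hnear : forall m, a <= m <= b -> exists d : posreal,
    F (fun x => forall s, m - d < s < m + d -> P x s)).
  { intros m Hm. destruct (Hloc m Hm) as [Q1 Q2 HQ1 [d HQ2] HP].
    exists d. apply (filter_imp Q1); [|exact HQ1].
    intros x Hx s Hs. apply (HP x s Hx), HQ2.
    change (Rabs (s - m) < d). apply Rabs_def1; lra. }
  assert (Hstep : forall m c (d : posreal),
    F (fun x => forall s, m - d < s < m + d -> P x s) ->
    reached c -> m - d < c -> forall c', c <= c' <= b -> c' < m + d -> reached c').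
  { intros m c d Hm [Hc HFc] Hcm c' Hc' Hcd. split; [lra|].
    apply (filter_imp _ _) with (2 := filter_and _ _ HFc Hm).
    intros x [Hleft Hright] s Hs. destruct (Rle_dec s c); [apply Hleft | apply Hright]; lra. }
  assert (Ha : reached a).
  { split; [lra|]. destruct (Hnear a) as [d Hd]; [lra|].
    apply (filter_imp _ _) with (2 := Hd).
    intros x Hx s Hs. apply Hx. assert (Hd0 := cond_pos d). lra. }
  destruct (completeness reached) as [m [Hub Hlub]].
  { exists b. intros c [Hc _]. lra. }
  { exists a. exact Ha. }
  assert (Hm : a <= m <= b)
    by (split; [apply Hub, Ha | apply Hlub; intros c [Hc _]; lra]).
  destruct (Hnear m Hm) as [d Hd]. assert (Hd0 := cond_pos d).
  assert (Hc : exists c, reached c /\ m - d < c).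
  { apply NNPP. intro Hnone. assert (m <= m - d); [|lra].
    apply Hlub. intros c Hc. apply Rnot_lt_le. eauto. }
  destruct Hc as [c [Hc Hcm]]. assert (Hcm' := Hub c Hc).
  destruct (Rlt_dec b (m + d)) as [Hlt | Hge].
  - apply (Hstep m c d Hd Hc Hcm b); [destruct Hc; lra | exact Hlt].
  - assert (Hbeyond : reached (m + d / 2))
      by (apply (Hstep m c d Hd Hc Hcm); destruct Hc; lra).
    apply Hub in Hbeyond. lra.
Qed.

Lemma locally_filter_prod {U V : UniformSpace} (x : U) (y : V) (P : U * V -> Prop) :
  locally (x, y) P -> filter_prod (locally x) (locally y) P.
Proof.
  intros [d Hd]. apply (Filter_prod _ _ _ (ball x d) (ball y d)).
  - apply locally_ball.
  - apply locally_ball.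
  - intros x' y' Hx Hy. apply Hd. split; assumption.
Qed.

Lemma open2_locally (W : R -> R -> Prop) (t r : R) :
  open2 W -> W t r -> locally (t, r) (fun p : R * R => W (fst p) (snd p)).
Proof.
  intros HW Htr. destruct (HW t r Htr) as [d [Hd HWd]].
  exists (mkposreal d Hd). intros [t' r'] [Ht Hr]. apply HWd; assumption.
Qed.

Lemma open2_locally_2d (W : R -> R -> Prop) (t r : R) :
  open2 W -> W t r -> locally_2d W t r.
Proof.
  intros HW Htr. apply locally_2d_locally, open2_locally; assumption.
Qed.

Lemma locally_open2 (W : R -> R -> Prop) :
  (forall t r, W t r -> locally (t, r) (fun p : R * R => W (fst p) (snd p))) ->
  open2 W.
Proof.
  intros HW t r Htr. destruct (HW t r Htr) as [d Hd].
  exists d. split; [apply cond_pos|].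
  intros t' r' Ht Hr. exact (Hd (t', r') (conj Ht Hr)).
Qed.

Lemma open2_and (V W : R -> R -> Prop) :
  open2 V -> open2 W -> open2 (fun t r => V t r /\ W t r).
Proof.
  intros HV HW. apply locally_open2. intros t r [HVtr HWtr].
  apply filter_and; apply open2_locally; assumption.
Qed.

Lemma open2_preimage (W : R -> R -> Prop) (g h : R -> R -> R) :
  open2 W ->
  (forall t r, continuity_2d_pt g t r) -> (forall t r, continuity_2d_pt h t r) ->
  open2 (fun t r => W (g t r) (h t r)).
Proof.
  intros HW Hg Hh. apply locally_open2. intros t r Htr.
  destruct (HW _ _ Htr) as [d [Hd HWd]].
  assert (Hgd := proj1 (locally_2d_locally _ _ _) (Hg t r (mkposreal d Hd))).
  assert (Hhd := proj1 (locally_2d_locally _ _ _) (Hh t r (mkposreal d Hd))).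
  apply (filter_imp _ _) with (2 := filter_and _ _ Hgd Hhd).
  intros p [Hp1 Hp2]. apply HWd; assumption.
Qed.

Lemma open2_half_plane_fst : open2 (fun t _ => 0 < t).
Proof.
  intros t r Ht. exists t. split; [exact Ht|].
  intros t' r' Ht' _. apply Rabs_def2 in Ht'. lra.
Qed.

Lemma open2_tube (W : R -> R -> Prop) (t a b : R) :
  open2 W -> a <= b -> (forall r, a <= r <= b -> W t r) ->
  exists d, 0 < d /\
    forall t' r, Rabs (t' - t) < d -> a - d < r < b + d -> W t' r.
Proof.
  intros HW Hab Hseg.
  destruct (HW t a) as [da [Hda Ha]]; [apply Hseg; lra|].
  destruct (HW t b) as [db [Hdb Hb]]; [apply Hseg; lra|].
  destruct (filter_forall_segment (locally t) W a b) as [d Hd].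
  { intros s Hs. apply locally_filter_prod, open2_locally; [exact HW|].
    apply Hseg, Hs. }
  exists (Rmin d (Rmin da db)).
  split; [repeat apply Rmin_pos; try assumption; apply cond_pos|].
  intros t' r Ht Hr. assert (Hd1 := Rmin_l d (Rmin da db)).
  assert (Hd2 := Rmin_r d (Rmin da db)).
  assert (Hd3 := Rmin_l da db). assert (Hd4 := Rmin_r da db).
  destruct (Rlt_dec r a); [apply Ha; [lra | apply Rabs_def1; lra]|].
  destruct (Rlt_dec b r); [apply Hb; [lra | apply Rabs_def1; lra]|].
  apply Hd; [change (Rabs (t' - t) < d)|]; lra.
Qed.

(** * Continuously differentiable functions of two variables *)

Record C1_at (f ft fr : R -> R -> R) (t r : R) : Prop := {
  C1_derive_fst : is_derive (fun x => f x r) t (ft t r);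
  C1_derive_snd : is_derive (fun x => f t x) r (fr t r);
  C1_continuous : continuity_2d_pt f t r;
  C1_continuous_fst : continuity_2d_pt ft t r;
  C1_continuous_snd : continuity_2d_pt fr t r
}.

Definition C1_on (W : R -> R -> Prop) (f ft fr : R -> R -> R) : Prop :=
  forall t r, W t r -> C1_at f ft fr t r.

Section C1_closure.
Variable W : R -> R -> Prop.

Lemma C1_on_const (c : R) : C1_on W (fun _ _ => c) (fun _ _ => 0) (fun _ _ => 0).
Proof.
  intros t r _. split;
    first [apply (@is_derive_const R_AbsRing) | apply continuity_2d_pt_const].
Qed.

Lemma C1_on_fst : C1_on W (fun t _ => t) (fun _ _ => 1) (fun _ _ => 0).
Proof.
  intros t r _. split; try apply continuity_2d_pt_const.
  - apply (@is_derive_id R_AbsRing).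
  - apply (@is_derive_const R_AbsRing).
  - apply continuity_2d_pt_id1.
Qed.

Lemma C1_on_snd : C1_on W (fun _ r => r) (fun _ _ => 0) (fun _ _ => 1).
Proof.
  intros t r _. split; try apply continuity_2d_pt_const.
  - apply (@is_derive_const R_AbsRing).
  - apply (@is_derive_id R_AbsRing).
  - apply continuity_2d_pt_id2.
Qed.

Lemma C1_on_plus f ft fr g gt gr : C1_on W f ft fr -> C1_on W g gt gr ->
  C1_on W (fun t r => f t r + g t r) (fun t r => ft t r + gt t r)
    (fun t r => fr t r + gr t r).
Proof.
  intros Hf Hg t r Htr. destruct (Hf t r Htr), (Hg t r Htr).
  split; try (apply continuity_2d_pt_plus; assumption);
    apply (@is_derive_plus R_AbsRing R_NormedModule); assumption.
Qed.

Lemma C1_on_minus f ft fr g gt gr : C1_on W f ft fr -> C1_on W g gt gr ->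
  C1_on W (fun t r => f t r - g t r) (fun t r => ft t r - gt t r)
    (fun t r => fr t r - gr t r).
Proof.
  intros Hf Hg t r Htr. destruct (Hf t r Htr), (Hg t r Htr).
  split; try (apply continuity_2d_pt_minus; assumption);
    apply (@is_derive_minus R_AbsRing R_NormedModule); assumption.
Qed.

Lemma C1_on_mult f ft fr g gt gr : C1_on W f ft fr -> C1_on W g gt gr ->
  C1_on W (fun t r => f t r * g t r) (fun t r => ft t r * g t r + f t r * gt t r)
    (fun t r => fr t r * g t r + f t r * gr t r).
Proof.
  intros Hf Hg t r Htr. destruct (Hf t r Htr), (Hg t r Htr).
  split; repeat (apply continuity_2d_pt_plus || apply continuity_2d_pt_mult);
    try assumption.
  - apply (is_derive_mult (fun x => f x r) (fun x => g x r));
      [assumption | assumption | exact Rmult_comm].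
  - apply (is_derive_mult (fun x => f t x) (fun x => g t x));
      [assumption | assumption | exact Rmult_comm].
Qed.

Lemma C1_on_comp1 (V : R -> Prop) (k dk : R -> R) f ft fr :
  (forall x, V x -> is_derive k x (dk x)) -> (forall x, V x -> continuity_pt dk x) ->
  (forall t r, W t r -> V (f t r)) -> C1_on W f ft fr ->
  C1_on W (fun t r => k (f t r)) (fun t r => ft t r * dk (f t r))
    (fun t r => fr t r * dk (f t r)).
Proof.
  intros Hk Hdk HV Hf t r Htr. assert (Hv := HV t r Htr). destruct (Hf t r Htr).
  split; try (apply continuity_2d_pt_mult; [assumption|]);
    try (apply continuity_1d_2d_pt_comp; [|assumption]); auto.
  - apply (is_derive_comp k (fun x => f x r)); auto.
  - apply (is_derive_comp k (fun x => f t x)); auto.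
  - apply derivable_continuous_pt. exists (dk (f t r)). apply is_derive_Reals, Hk, Hv.
Qed.

Lemma C1_on_sin f ft fr : C1_on W f ft fr ->
  C1_on W (fun t r => sin (f t r)) (fun t r => ft t r * cos (f t r))
    (fun t r => fr t r * cos (f t r)).
Proof.
  apply (C1_on_comp1 (fun _ => True) sin cos); auto; intros x _.
  - apply is_derive_sin.
  - apply continuity_cos.
Qed.

Lemma C1_on_cos f ft fr : C1_on W f ft fr ->
  C1_on W (fun t r => cos (f t r)) (fun t r => ft t r * - sin (f t r))
    (fun t r => fr t r * - sin (f t r)).
Proof.
  apply (C1_on_comp1 (fun _ => True) cos (fun x => - sin x)); auto; intros x _.
  - apply is_derive_cos.
  - apply continuity_pt_opp, continuity_sin.
Qed.

Lemma C1_on_exp f ft fr : C1_on W f ft fr ->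
  C1_on W (fun t r => exp (f t r)) (fun t r => ft t r * exp (f t r))
    (fun t r => fr t r * exp (f t r)).
Proof.
  apply (C1_on_comp1 (fun _ => True) exp exp); auto; intros x _.
  - apply is_derive_exp.
  - apply derivable_continuous_pt, derivable_pt_exp.
Qed.

Lemma C1_on_pow (n : nat) f ft fr : C1_on W f ft fr ->
  C1_on W (fun t r => f t r ^ n) (fun t r => ft t r * (INR n * f t r ^ pred n))
    (fun t r => fr t r * (INR n * f t r ^ pred n)).
Proof.
  apply (C1_on_comp1 (fun _ => True) (fun x => x ^ n) (fun x => INR n * x ^ pred n));
    auto; intros x _.
  - auto_derive; [auto | ring].
  - reg.
Qed.

Lemma C1_on_inv f ft fr : (forall t r, W t r -> f t r <> 0) -> C1_on W f ft fr ->
  C1_on W (fun t r => / f t r) (fun t r => ft t r * - / (f t r ^ 2))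
    (fun t r => fr t r * - / (f t r ^ 2)).
Proof.
  intros Hf0.
  apply (C1_on_comp1 (fun x => x <> 0) Rinv (fun x => - / x ^ 2));
    [intros x Hx | intros x Hx | exact Hf0].
  - auto_derive; [exact Hx | field; exact Hx].
  - reg. apply pow_nonzero, Hx.
Qed.

End C1_closure.

Lemma C1_on_sub (V W : R -> R -> Prop) f ft fr :
  (forall t r, V t r -> W t r) -> C1_on W f ft fr -> C1_on V f ft fr.
Proof. intros HVW Hf t r Htr. apply Hf, HVW, Htr. Qed.

Section C1_open.
Variable W : R -> R -> Prop.
Hypothesis W_open : open2 W.

Lemma C1_on_ext_derive f ft fr ft' fr' :
  (forall t r, W t r -> ft t r = ft' t r) -> (forall t r, W t r -> fr t r = fr' t r) ->
  C1_on W f ft fr -> C1_on W f ft' fr'.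
Proof.
  intros Ht Hr Hf t r Htr. destruct (Hf t r Htr).
  assert (Hnear := open2_locally_2d W t r W_open Htr).
  split; try assumption.
  - rewrite <- Ht; assumption.
  - rewrite <- Hr; assumption.
  - apply (continuity_2d_pt_ext_loc ft); [|assumption].
    revert Hnear. apply locally_2d_impl, locally_2d_forall. exact Ht.
  - apply (continuity_2d_pt_ext_loc fr); [|assumption].
    revert Hnear. apply locally_2d_impl, locally_2d_forall. exact Hr.
Qed.

Lemma C1_on_Derive_continuous f ft fr t r : C1_on W f ft fr -> W t r ->
  continuity_2d_pt (fun x y => Derive (fun z => f z y) x) t r.
Proof.
  intros Hf Htr. apply (continuity_2d_pt_ext_loc ft); [|apply (Hf t r Htr)].
  assert (Hnear := open2_locally_2d W t r W_open Htr).
  revert Hnear. apply locally_2d_impl, locally_2d_forall.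
  intros x y Hxy. symmetry. apply is_derive_unique, (Hf x y Hxy).
Qed.

Lemma C1_on_derive_unique f ft fr g gt gr t r :
  (forall x y, W x y -> f x y = g x y) -> C1_on W f ft fr -> C1_on W g gt gr ->
  W t r -> ft t r = gt t r /\ fr t r = gr t r.
Proof.
  intros Hfg Hf Hg Htr. destruct (Hf t r Htr), (Hg t r Htr).
  destruct (W_open t r Htr) as [d [Hd HWd]].
  assert (Hself : forall x, Rabs (x - x) < d)
    by (intro x; rewrite Rminus_diag, Rabs_R0; exact Hd).
  split.
  - rewrite <- (is_derive_unique (fun x => g x r) t (gt t r)) by assumption.
    symmetry. apply is_derive_unique.
    apply (is_derive_ext_loc (fun x => f x r)); [|assumption].
    exists (mkposreal d Hd). intros x Hx. apply Hfg, HWd; [exact Hx | apply Hself].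
  - rewrite <- (is_derive_unique (fun x => g t x) r (gr t r)) by assumption.
    symmetry. apply is_derive_unique.
    apply (is_derive_ext_loc (fun x => f t x)); [|assumption].
    exists (mkposreal d Hd). intros x Hx. apply Hfg, HWd; [apply Hself | exact Hx].
Qed.

Lemma C1_on_differentiable f ft fr t r :
  C1_on W f ft fr -> W t r -> differentiable_pt_lim f t r (ft t r) (fr t r).
Proof.
  intros Hf Htr. apply filterdiff_differentiable_pt_lim.
  destruct (Hf t r Htr) as [_ Hder_snd _ Hcont_fst _].
  apply (is_derive_filterdiff f t r ft (fr t r)).
  - apply (filter_imp _ _) with (2 := open2_locally W t r W_open Htr).
    intros p Hp. exact (C1_derive_fst _ _ _ _ _ (Hf _ _ Hp)).
  - exact Hder_snd.
  - apply continuity_2d_pt_filterlim. exact Hcont_fst.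
Qed.

Lemma C1_on_comp2 (V : R -> R -> Prop) f ft fr g gt gr h ht hr :
  (forall t r, V t r -> W (g t r) (h t r)) ->
  C1_on W f ft fr -> C1_on V g gt gr -> C1_on V h ht hr ->
  C1_on V (fun t r => f (g t r) (h t r))
    (fun t r => ft (g t r) (h t r) * gt t r + fr (g t r) (h t r) * ht t r)
    (fun t r => ft (g t r) (h t r) * gr t r + fr (g t r) (h t r) * hr t r).
Proof.
  intros HVW Hf Hg Hh t r Htr. assert (Hgh := HVW t r Htr).
  assert (Hdiff := C1_on_differentiable f ft fr _ _ Hf Hgh).
  destruct (Hf _ _ Hgh), (Hg t r Htr), (Hh t r Htr).
  assert (Hcomp : forall k, continuity_2d_pt k (g t r) (h t r) ->
    continuity_2d_pt (fun x y => k (g x y) (h x y)) t r).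
  { intros k Hk. apply continuity_2d_pt_filterlim.
    apply (continuous_comp_2 (fun p : R * R => g (fst p) (snd p))
      (fun p : R * R => h (fst p) (snd p)) k (t, r));
      apply continuity_2d_pt_filterlim; assumption. }
  split; repeat (apply continuity_2d_pt_plus || apply continuity_2d_pt_mult);
    try apply Hcomp; try assumption; apply is_derive_Reals.
  - apply (derivable_pt_lim_comp_2d f (fun x => g x r) (fun x => h x r));
      [exact Hdiff | apply is_derive_Reals; assumption ..].
  - apply (derivable_pt_lim_comp_2d f (fun x => g t x) (fun x => h t x));
      [exact Hdiff | apply is_derive_Reals; assumption ..].
Qed.

End C1_open.

Ltac C1_auto :=
  repeat first
  [ eassumption
  | match goal with
    | |- C1_on _ (fun t r => _ + _) _ _ => apply C1_on_plus
    | |- C1_on _ (fun t r => _ - _) _ _ => apply C1_on_minus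
    | |- C1_on _ (fun t r => _ * _) _ _ => apply C1_on_mult
    | |- C1_on _ (fun t r => _ / _) _ _ => apply C1_on_mult
    | |- C1_on _ (fun t r => _ ^ _) _ _ => apply C1_on_pow
    | |- C1_on _ (fun t r => sin _) _ _ => apply C1_on_sin
    | |- C1_on _ (fun t r => cos _) _ _ => apply C1_on_cos
    | |- C1_on _ (fun t r => exp _) _ _ => apply C1_on_exp
    | |- C1_on _ (fun t r => / _) _ _ => apply C1_on_inv
    | |- C1_on _ (fun t r => t) _ _ => apply C1_on_fst
    | |- C1_on _ (fun t r => r) _ _ => apply C1_on_snd
    | |- C1_on _ (fun t r => ?c) _ _ => apply (C1_on_const _ c)
    end ].

(** * Integrals over moving slices *)

Lemma ex_RInt_continuous_on (f : R -> R) (a b : R) :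
  a <= b -> (forall x, a <= x <= b -> continuous f x) -> ex_RInt f a b.
Proof.
  intros Hab Hf. apply (@ex_RInt_continuous R_CompleteNormedModule).
  intros x Hx. rewrite Rmin_left, Rmax_right in Hx by exact Hab. apply Hf, Hx.
Qed.

Lemma RInt_ext_on (f g : R -> R) (a b : R) :
  a <= b -> (forall x, a < x < b -> f x = g x) -> RInt f a b = RInt g a b.
Proof.
  intros Hab Hfg. apply RInt_ext. intros x Hx.
  rewrite Rmin_left, Rmax_right in Hx by exact Hab. apply Hfg, Hx.
Qed.

Lemma RInt_split (f : R -> R) (a b c : R) :
  a <= b <= c -> ex_RInt f a c -> RInt f a c = RInt f a b + RInt f b c.
Proof.
  intros Hb Hf. symmetry. apply (@RInt_Chasles R_CompleteNormedModule).
  - apply (@ex_RInt_Chasles_1 R_CompleteNormedModule f a b c Hb Hf).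
  - apply (@ex_RInt_Chasles_2 R_CompleteNormedModule f a b c Hb Hf).
Qed.

Lemma RInt_subinterval_le (f : R -> R) (a b c d : R) :
  a <= b -> b <= c -> c <= d -> ex_RInt f a d ->
  (forall x, a < x < d -> 0 <= f x) -> RInt f b c <= RInt f a d.
Proof.
  intros Hab Hbc Hcd Hf Hpos.
  assert (Hfb : ex_RInt f b d)
    by (apply (@ex_RInt_Chasles_2 R_CompleteNormedModule f a b d); [lra | exact Hf]).
  rewrite (RInt_split f a b d), (RInt_split f b c d); try assumption; try lra.
  assert (0 <= RInt f a b).
  { apply RInt_ge_0; [exact Hab | | intros x Hx; apply Hpos; lra].
    apply (@ex_RInt_Chasles_1 R_CompleteNormedModule f a b d); [lra | exact Hf]. }
  assert (0 <= RInt f c d); [|lra].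
  apply RInt_ge_0; [exact Hcd | | intros x Hx; apply Hpos; lra].
  apply (@ex_RInt_Chasles_2 R_CompleteNormedModule f b c d); [lra | exact Hfb].
Qed.

Lemma is_RInt_affine (f : R -> R) (a b k c If : R) :
  is_RInt f a b If -> is_RInt (fun x => k * f x + c) a b (k * If + c * (b - a)).
Proof.
  intros Hf. rewrite (Rmult_comm c).
  apply (@is_RInt_plus R_NormedModule).
  - apply (@is_RInt_scal R_NormedModule), Hf.
  - apply (@is_RInt_const R_NormedModule).
Qed.

Lemma RInt_ge_affine (f g : R -> R) (a b k c : R) :
  a <= b -> ex_RInt f a b -> ex_RInt g a b ->
  (forall x, a < x < b -> k * g x + c <= f x) ->
  k * RInt g a b + c * (b - a) <= RInt f a b.
Proof.
  intros Hab Hf Hg Hfg.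
  apply (is_RInt_le (fun x => k * g x + c) f a b); [exact Hab | | | exact Hfg].
  - apply is_RInt_affine, (@RInt_correct R_CompleteNormedModule), Hg.
  - apply (@RInt_correct R_CompleteNormedModule), Hf.
Qed.

Lemma Rabs_RInt_le_affine (f g : R -> R) (a b k c : R) :
  a <= b -> ex_RInt f a b -> ex_RInt g a b ->
  (forall x, a < x < b -> Rabs (f x) <= k * g x + c) ->
  Rabs (RInt f a b) <= k * RInt g a b + c * (b - a).
Proof.
  intros Hab Hf Hg Hfg.
  assert (Hlow : - k * RInt g a b + - c * (b - a) <= RInt f a b).
  { apply RInt_ge_affine; try assumption.
    intros x Hx. specialize (Hfg x Hx). apply Rabs_le_between in Hfg. lra. }
  assert (Hup : RInt f a b <= k * RInt g a b + c * (b - a)).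
  { apply (is_RInt_le f (fun x => k * g x + c) a b); [exact Hab | | |].
    - apply (@RInt_correct R_CompleteNormedModule), Hf.
    - apply is_RInt_affine, (@RInt_correct R_CompleteNormedModule), Hg.
    - intros x Hx. specialize (Hfg x Hx). apply Rabs_le_between in Hfg. lra. }
  apply Rabs_le. lra.
Qed.

Lemma continuous_snd_slice (f : R -> R -> R) (t r : R) :
  continuity_2d_pt f t r -> continuous (f t) r.
Proof.
  intros Hf. apply (continuous_comp_2 (fun _ : R => t) (fun x : R => x) f r).
  - apply continuous_const.
  - apply continuous_id.
  - apply continuity_2d_pt_filterlim, Hf.
Qed.

Lemma C1_on_slice_ex_RInt (W : R -> R -> Prop) f ft fr t a b :
  C1_on W f ft fr -> a <= b -> (forall r, a <= r <= b -> W t r) ->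
  ex_RInt (f t) a b.
Proof.
  intros Hf Hab Hseg. apply ex_RInt_continuous_on; [exact Hab|].
  intros r Hr. apply continuous_snd_slice, (C1_continuous _ _ _ _ _ (Hf t r (Hseg r Hr))).
Qed.

Lemma C1_on_slice_FTC (W : R -> R -> Prop) f ft fr t a b :
  C1_on W f ft fr -> a <= b -> (forall r, a <= r <= b -> W t r) ->
  is_RInt (fr t) a b (f t b - f t a).
Proof.
  intros Hf Hab Hseg.
  apply (@is_RInt_derive R_CompleteNormedModule (f t));
    intros r Hr; rewrite Rmin_left, Rmax_right in Hr by exact Hab.
  - apply (Hf t r (Hseg r Hr)).
  - apply continuous_snd_slice, (Hf t r (Hseg r Hr)).
Qed.

Lemma is_derive_RInt_slice (W : R -> R -> Prop) A At Ar (l h : R -> R) dl dh t :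
  open2 W -> C1_on W A At Ar -> is_derive l t dl -> is_derive h t dh -> l t <= h t ->
  (forall r, l t <= r <= h t -> W t r) ->
  is_derive (fun x => RInt (A x) (l x) (h x)) t
    (A t (h t) * dh - A t (l t) * dl + RInt (At t) (l t) (h t)).
Proof.
  intros HW HA Hl Hh Hlh Hseg.
  destruct (open2_tube W t (l t) (h t) HW Hlh Hseg) as [d [Hd Htube]].
  assert (Hd2 : 0 < d / 2) by lra.
  set (near_t := fun x => Rabs (x - t) < d).
  assert (Hnear : locally t near_t) by (exists (mkposreal d Hd); auto).
  assert (HDer : forall x y, W x y -> Derive (fun z => A z y) x = At x y).
  { intros x y Hxy. apply is_derive_unique, (HA x y Hxy). }
  assert (Hcont_near : forall y, W t y -> locally_2d (fun x' y' =>
    continuity_2d_pt (fun u v => Derive (fun z => A z v) u) x' y') t y).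
  { intros y Hy. apply locally_2d_locally.
    apply (filter_imp _ _) with (2 := open2_locally W t y HW Hy).
    intros p Hp. apply (C1_on_Derive_continuous W HW A At Ar _ _ HA Hp). }
  assert (Hex : forall p q, l t - d < p -> p <= q -> q < h t + d ->
    locally t (fun x => ex_RInt (fun y => A x y) p q)).
  { intros p q Hp Hpq Hq. apply (filter_imp near_t); [|exact Hnear]. intros x Hx.
    apply (C1_on_slice_ex_RInt W A At Ar); [exact HA | exact Hpq|].
    intros r Hr. apply Htube; [exact Hx | lra]. }
  assert (Hcont_slice : forall y, W t y -> continuity_pt (fun r => A t r) y).
  { intros y Hy. apply continuity_pt_filterlim, continuous_snd_slice, (HA t y Hy). }
  assert (Hlt := Hseg (l t) ltac:(lra)). assert (Hht := Hseg (h t) ltac:(lra)).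
  replace (RInt (At t) (l t) (h t)) with (RInt (fun y => Derive (fun z => A z y) t) (l t) (h t))
    by (apply RInt_ext_on; [exact Hlh | intros y Hy; apply HDer, Hseg; lra]).
  evar_last.
  - apply (is_derive_RInt_param_bound_comp A l h t dl dh); auto.
    + apply Hex; lra.
    + exists (mkposreal _ Hd2). apply Hex; simpl; lra.
    + exists (mkposreal _ Hd2). apply Hex; simpl; lra.
    + exists (mkposreal _ Hd2). apply (filter_imp near_t); [|exact Hnear].
      intros x Hx y Hy. simpl in Hy. rewrite Rmin_left, Rmax_right in Hy by lra.
      exists (At x y). apply (HA x y), Htube; [exact Hx | lra].
    + intros y Hy. rewrite Rmin_left, Rmax_right in Hy by exact Hlh.
      apply (C1_on_Derive_continuous W HW A At Ar t y HA (Hseg y Hy)).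
  - ring.
Qed.

Lemma is_derive_RInt_fixed (W : R -> R -> Prop) A At Ar a b t :
  open2 W -> C1_on W A At Ar -> a <= b -> (forall r, a <= r <= b -> W t r) ->
  is_derive (fun x => RInt (A x) a b) t (RInt (At t) a b).
Proof.
  intros HW HA Hab Hseg. evar_last.
  - apply (is_derive_RInt_slice W A At Ar (fun _ => a) (fun _ => b) 0 0 t HW HA);
      try apply (@is_derive_const R_AbsRing); assumption.
  - ring.
Qed.

Lemma C1_on_slice_RInt_derive (W : R -> R -> Prop) f ft fr t a b :
  open2 W -> C1_on W f ft fr -> a <= b -> (forall r, a <= r <= b -> W t r) ->
  is_derive (fun x => RInt (f t) a x) b (f t b).
Proof.
  intros HW Hf Hab Hseg. set (V := fun _ : R => W t).
  assert (HV : open2 V)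
    by (apply (open2_preimage W (fun _ _ => t) (fun _ r => r)); [exact HW | |];
        intros x r; [apply continuity_2d_pt_const | apply continuity_2d_pt_id2]).
  assert (HA : exists Ar, C1_on V (fun _ r => f t r) (fun _ _ => 0) Ar).
  { eexists. eapply (C1_on_ext_derive V HV); [| reflexivity |].
    2: { eapply (C1_on_comp2 W HW V f ft fr (fun _ _ => t) _ _ (fun _ r => r));
           [auto | exact Hf | C1_auto ..]. }
    intros x r _. simpl. ring. }
  destruct HA as [Ar HA]. evar_last.
  - apply (is_derive_RInt_slice V _ _ Ar (fun _ => a) (fun x => x) 0 1 b HV HA);
      [| | exact Hab | exact Hseg].
    + apply (@is_derive_const R_AbsRing).
    + apply (@is_derive_id R_AbsRing).
  - simpl. rewrite RInt_const. unfold scal; simpl; unfold mult; simpl. ring.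
Qed.

(* [G] is the part of [W] on which the identity is known: it holds on the light
   cone only, and at the axis merely by continuity. *)
Definition balance (W G : R -> R -> Prop) (A B C : R -> R -> R) : Prop :=
  exists At Ar Bt Br, C1_on W A At Ar /\ C1_on W B Bt Br /\
    forall t r, G t r -> At t r - Br t r = C t r.

Lemma balance_slice (W G : R -> R -> Prop) A B C (l h : R -> R) dl dh t :
  open2 W -> balance W G A B C -> is_derive l t dl -> is_derive h t dh -> l t <= h t ->
  (forall r, l t <= r <= h t -> W t r) -> (forall r, l t < r < h t -> G t r) ->
  ex_RInt (C t) (l t) (h t) /\
  is_derive (fun x => RInt (A x) (l x) (h x)) t
    (A t (h t) * dh - A t (l t) * dl + (B t (h t) - B t (l t))
     + RInt (C t) (l t) (h t)).
Proof.
  intros HW (At & Ar & Bt & Br & HA & HB & HC) Hl Hh Hlh Hseg HG.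
  assert (HAt : ex_RInt (At t) (l t) (h t)).
  { apply ex_RInt_continuous_on; [exact Hlh|]. intros r Hr.
    apply continuous_snd_slice, (HA t r (Hseg r Hr)). }
  assert (HBr := C1_on_slice_FTC W B Bt Br t (l t) (h t) HB Hlh Hseg).
  assert (HCint : is_RInt (C t) (l t) (h t)
    (RInt (At t) (l t) (h t) - (B t (h t) - B t (l t)))).
  { apply (is_RInt_ext (fun r => At t r - Br t r)).
    - intros r Hr. rewrite Rmin_left, Rmax_right in Hr by exact Hlh. apply HC, HG, Hr.
    - apply (@is_RInt_minus R_NormedModule); [|exact HBr].
      apply (@RInt_correct R_CompleteNormedModule), HAt. }
  split; [eexists; exact HCint|].
  rewrite (is_RInt_unique _ _ _ _ HCint).
  evar_last; [apply (is_derive_RInt_slice W A At Ar l h dl dh); assumption | ring].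
Qed.

Lemma continuous_RInt_param {X : UniformSpace} (f : X -> R -> R) (a b : R) (x : X) :
  a <= b ->
  locally x (fun y => forall s, a <= s <= b -> continuous (f y) s) ->
  (forall s, a <= s <= b -> continuous (fun p : X * R => f (fst p) (snd p)) (x, s)) ->
  continuous (fun y => RInt (f y) a b) x.
Proof.
  intros Hab Hslice Hjoint. apply filterlim_locally. intros eps.
  set (d := pos eps / (2 * (b - a + 1))).
  assert (Hd : 0 < d) by (apply Rdiv_lt_0_compat; [apply cond_pos | lra]).
  assert (Hdhalf : 0 < d / 2) by lra.
  assert (Hclose : locally x (fun y => forall s, a <= s <= b -> Rabs (f y s - f x s) < d)).
  { apply (filter_forall_segment (locally x) (fun y s => Rabs (f y s - f x s) < d)).
    intros s Hs. apply locally_filter_prod.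
    destruct (proj1 (filterlim_locally _ _) (Hjoint s Hs) (mkposreal _ Hdhalf)) as [e He].
    exists e. intros [y s'] [Hy Hs'].
    assert (Hfy := He (y, s') (conj Hy Hs')).
    assert (Hfx := He (x, s') (conj (ball_center x e) Hs')).
    change (Rabs (f y s' - f x s) < d / 2) in Hfy.
    change (Rabs (f x s' - f x s) < d / 2) in Hfx.
    apply Rabs_def2 in Hfy. apply Rabs_def2 in Hfx. simpl. apply Rabs_def1; lra. }
  assert (Hx := locally_singleton _ _ Hslice).
  apply (filter_imp _ _) with (2 := filter_and _ _ Hslice Hclose).
  intros y [Hy Hyx]. change (Rabs (RInt (f y) a b - RInt (f x) a b) < eps).
  assert (Hexy : ex_RInt (f y) a b) by (apply ex_RInt_continuous_on; assumption).
  assert (Hexx : ex_RInt (f x) a b) by (apply ex_RInt_continuous_on; assumption).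
  assert (Hminus : RInt (fun s => f y s - f x s) a b = RInt (f y) a b - RInt (f x) a b)
    by (apply (@RInt_minus R_CompleteNormedModule); assumption).
  rewrite <- Hminus.
  apply Rle_lt_trans with ((b - a) * d).
  - apply abs_RInt_le_const; [exact Hab | | intros s Hs; left; auto].
    apply (@ex_RInt_minus R_NormedModule); assumption.
  - apply Rlt_le_trans with ((b - a + 1) * d + (b - a + 1) * d); [nra|].
    right. unfold d. field. lra.
Qed.

(** * Hadamard's quotient *)

Definition radial_core (W : R -> R -> Prop) (t r : R) : Prop :=
  forall s, 0 <= s <= 1 -> W t (s * r).

Definition ray_moment (n : nat) (f : R -> R -> R) (t r : R) : R :=
  RInt (fun s => s ^ n * f t (s * r)) 0 1.

Section Rays.
Variable W : R -> R -> Prop.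
Hypothesis W_open : open2 W.

Lemma continuous_ray (t r s : R) :
  continuous (fun p : (R * R) * R => (fst (fst p), snd p * snd (fst p))) ((t, r), s).
Proof.
  apply (continuous_comp_2 (fun p : (R * R) * R => fst (fst p))
    (fun p : (R * R) * R => snd p * snd (fst p)) pair).
  - apply (continuous_comp fst fst); apply continuous_fst.
  - apply (@continuous_mult _ R_AbsRing);
      [apply continuous_snd|].
    apply (continuous_comp fst snd); [apply continuous_fst | apply continuous_snd].
  - apply (continuous_ext (fun p : R * R => p)); [|apply continuous_id].
    intros [x y]. reflexivity.
Qed.

Lemma open2_radial_core : open2 (radial_core W).
Proof.
  apply locally_open2. intros t r Htr.
  apply (filter_forall_segment (locally (t, r)) (fun p s => W (fst p) (s * snd p))).
  intros s Hs. apply locally_filter_prod.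
  apply (continuous_ray t r s (fun q : R * R => W (fst q) (snd q))).
  apply open2_locally; [exact W_open | apply Htr, Hs].
Qed.

Lemma radial_core_sub (t r : R) : radial_core W t r -> W t r.
Proof. intros Htr. rewrite <- (Rmult_1_l r). apply Htr. lra. Qed.

Lemma ray_moment_continuous (n : nat) (f : R -> R -> R) (t r : R) :
  (forall x y, W x y -> continuity_2d_pt f x y) -> radial_core W t r ->
  continuity_2d_pt (ray_moment n f) t r.
Proof.
  intros Hf Htr. apply continuity_2d_pt_filterlim.
  set (F := fun (p : R * R) s => s ^ n * f (fst p) (s * snd p)).
  assert (Hjoint : forall p s, W (fst p) (s * snd p) ->
    continuous (fun q : (R * R) * R => F (fst q) (snd q)) (p, s)).
  { intros [x y] s Hxy.
    apply (@continuous_mult _ R_AbsRing).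
    - apply (continuous_comp snd (fun z : R => z ^ n)); [apply continuous_snd|].
      apply (@ex_derive_continuous R_AbsRing R_NormedModule). auto_derive. auto.
    - apply (continuous_comp (fun q : (R * R) * R => (fst (fst q), snd q * snd (fst q)))
        (fun q : R * R => f (fst q) (snd q))); [apply continuous_ray|].
      apply continuity_2d_pt_filterlim, Hf, Hxy. }
  apply (continuous_RInt_param F 0 1 (t, r)); [lra | | intros s Hs; apply Hjoint, Htr, Hs].
  apply (filter_imp _ _) with (2 := open2_locally _ t r open2_radial_core Htr).
  intros p Hp s Hs.
  apply (continuous_comp_2 (fun _ : R => p) (fun z : R => z) F s).
  - apply continuous_const.
  - apply continuous_id.
  - apply Hjoint, Hp, Hs.
Qed.

Lemma ray_moment_derive_fst (n : nat) f ft fr t r : C1_on W f ft fr ->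
  radial_core W t r -> is_derive (fun x => ray_moment n f x r) t (ray_moment n ft t r).
Proof.
  intros Hf Htr. set (V := fun x s => W x (s * r)).
  assert (HV : open2 V).
  { apply (open2_preimage W (fun x _ => x) (fun _ s => s * r)); [exact W_open | |];
      intros x s; [apply continuity_2d_pt_id1|].
    apply continuity_2d_pt_mult; [apply continuity_2d_pt_id2 | apply continuity_2d_pt_const]. }
  assert (HA : exists Ar, C1_on V (fun x s => s ^ n * f x (s * r))
    (fun x s => s ^ n * ft x (s * r)) Ar).
  { eexists. eapply (C1_on_ext_derive V HV); [| reflexivity |].
    2: { C1_auto. eapply (C1_on_comp2 W W_open V f ft fr (fun x _ => x) _ _ (fun _ s => s * r));
           [auto | exact Hf | C1_auto ..]. }
    intros x s _. simpl. ring. }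
  destruct HA as [Ar HA]. exact (is_derive_RInt_fixed V _ _ Ar 0 1 t HV HA Rle_0_1 Htr).
Qed.

Lemma ray_moment_derive_snd (n : nat) f ft fr t r : C1_on W f ft fr ->
  radial_core W t r -> is_derive (fun x => ray_moment n f t x) r (ray_moment (S n) fr t r).
Proof.
  intros Hf Htr. set (V := fun x s => W t (s * x)).
  assert (HV : open2 V).
  { apply (open2_preimage W (fun _ _ => t) (fun x s => s * x)); [exact W_open | |];
      intros x s; [apply continuity_2d_pt_const|].
    apply continuity_2d_pt_mult; [apply continuity_2d_pt_id2 | apply continuity_2d_pt_id1]. }
  assert (HA : exists Ar, C1_on V (fun x s => s ^ n * f t (s * x))
    (fun x s => s ^ S n * fr t (s * x)) Ar).
  { eexists. eapply (C1_on_ext_derive V HV); [| reflexivity |].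
    2: { C1_auto. eapply (C1_on_comp2 W W_open V f ft fr (fun _ _ => t) _ _ (fun x s => s * x));
           [auto | exact Hf | C1_auto ..]. }
    intros x s _. simpl. ring. }
  destruct HA as [Ar HA]. exact (is_derive_RInt_fixed V _ _ Ar 0 1 r HV HA Rle_0_1 Htr).
Qed.

Lemma C1_on_ray_moment (n : nat) f ft fr : C1_on W f ft fr ->
  C1_on (radial_core W) (ray_moment n f) (ray_moment n ft) (ray_moment (S n) fr).
Proof.
  intros Hf t r Htr. split.
  - apply (ray_moment_derive_fst n f ft fr); assumption.
  - apply (ray_moment_derive_snd n f ft fr); assumption.
  - apply ray_moment_continuous; [intros x y Hxy; apply (Hf x y Hxy) | exact Htr].
  - apply ray_moment_continuous; [intros x y Hxy; apply (Hf x y Hxy) | exact Htr].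
  - apply ray_moment_continuous; [intros x y Hxy; apply (Hf x y Hxy) | exact Htr].
Qed.

Lemma hadamard f ft fr t r : C1_on W f ft fr -> radial_core W t r ->
  r * ray_moment 0 fr t r = f t r - f t 0.
Proof.
  intros Hf Htr.
  assert (Hray : forall s, is_derive (fun s => s * r) s r)
    by (intro s; auto_derive; [auto | ring]).
  assert (Hcont : forall s, 0 <= s <= 1 -> continuous (fun s => fr t (s * r)) s).
  { intros s Hs. apply (continuous_comp (fun s => s * r) (fr t)).
    - apply (@ex_derive_continuous R_AbsRing R_NormedModule). eexists. apply Hray.
    - apply continuous_snd_slice, (Hf _ _ (Htr s Hs)). }
  assert (Hint : is_RInt (fun s => r * fr t (s * r)) 0 1 (f t (1 * r) - f t (0 * r))).
  { apply (@is_RInt_derive R_CompleteNormedModule (fun s => f t (s * r)));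
      intros s Hs; rewrite Rmin_left, Rmax_right in Hs by lra.
    - apply (is_derive_comp (f t) (fun s => s * r)); [apply (Hf _ _ (Htr s Hs)) | apply Hray].
    - apply (@continuous_mult R_UniformSpace R_AbsRing);
        [apply continuous_const | apply Hcont, Hs]. }
  rewrite Rmult_1_l, Rmult_0_l in Hint. rewrite <- (is_RInt_unique _ _ _ _ Hint).
  unfold ray_moment. rewrite (RInt_ext_on (fun s => s ^ 0 * fr t (s * r)) (fun s => fr t (s * r)));
    [| lra | intros s _; simpl; ring].
  symmetry. apply (@RInt_scal R_CompleteNormedModule).
  apply ex_RInt_continuous_on; [lra | exact Hcont].
Qed.

End Rays.

(** * Monotonicity and elementary inequalities *)

Lemma nondecreasing_of_derive (f : R -> R) (a b : R) :
  a <= b -> (forall x, a <= x <= b -> exists d, is_derive f x d /\ 0 <= d) -> f a <= f b.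
Proof.
  intros Hab Hder.
  assert (HD : forall x, a <= x <= b -> is_derive f x (Derive f x) /\ 0 <= Derive f x).
  { intros x Hx. destruct (Hder x Hx) as [d [Hd Hpos]].
    rewrite (is_derive_unique _ _ _ Hd). split; assumption. }
  destruct (MVT_gen f a b (Derive f)) as [c [Hc Heq]];
    rewrite Rmin_left, Rmax_right in * by exact Hab.
  - intros x Hx. apply HD. lra.
  - intros x Hx. apply derivable_continuous_pt. exists (Derive f x).
    apply is_derive_Reals, HD, Hx.
  - destruct (HD c Hc) as [_ Hpos]. nra.
Qed.

Lemma nondecreasing_oscillation (f : R -> R) (m b eps : R) : 0 < b -> 0 < eps ->
  (forall t, 0 < t <= b -> m <= f t) ->
  (forall s t, 0 < s -> s <= t -> t <= b -> f s <= f t) ->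
  exists d, 0 < d <= b /\ forall s t, 0 < s -> s <= t -> t <= d -> f t - f s <= eps.
Proof.
  intros Hb Heps Hlow Hmono.
  destruct (completeness (fun x => exists t, 0 < t <= b /\ x = - f t)) as [M [Hub Hlub]].
  - exists (- m). intros x [t [Ht ->]]. specialize (Hlow t Ht). lra.
  - exists (- f b), b. lra.
  - assert (Hex : exists d, 0 < d <= b /\ M - eps < - f d).
    { apply NNPP. intro Hnone. assert (M <= M - eps); [|lra].
      apply Hlub. intros x [t [Ht ->]]. apply Rnot_lt_le. eauto. }
    destruct Hex as [d [Hd HM]]. exists d. split; [exact Hd|].
    intros s t Hs Hst Htd.
    assert (- f s <= M) by (apply Hub; exists s; lra).
    assert (f t <= f d) by (apply Hmono; lra). lra.
Qed.

Lemma at_right_0_interval (d : R) : 0 < d -> at_right 0 (fun t => 0 < t < d).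
Proof.
  intros Hd. exists (mkposreal d Hd). intros t Ht Ht0.
  change (Rabs (t - 0) < d) in Ht. apply Rabs_def2 in Ht. lra.
Qed.

Lemma at_right_0_exists (P : R -> Prop) :
  at_right 0 P -> exists d, 0 < d /\ forall t, 0 < t < d -> P t.
Proof.
  intros [d Hd]. exists d. split; [apply cond_pos|].
  intros t Ht. apply Hd; [|lra].
  change (Rabs (t - 0) < d). apply Rabs_def1; lra.
Qed.

Lemma at_right_0_scale (k : R) (P : R -> Prop) :
  0 < k -> at_right 0 P -> at_right 0 (fun t => P (k * t)).
Proof.
  intros Hk HP. destruct (at_right_0_exists P HP) as [d [Hd HPd]].
  apply (filter_imp (fun t => 0 < t < d / k)).
  - intros t [Ht0 Ht]. apply HPd. split; [nra|].
    apply (Rmult_lt_compat_l k) in Ht; [|exact Hk].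
    replace (k * (d / k)) with d in Ht by (field; lra). exact Ht.
  - apply at_right_0_interval, Rdiv_lt_0_compat; assumption.
Qed.

Lemma is_derive_zero_of_left_constant (f : R -> R) (x l : R) :
  is_derive f x l -> at_left x (fun y => f y = f x) -> l = 0.
Proof.
  intros Hder [d Hd]. apply is_derive_Reals in Hder.
  apply cond_eq. intros eps Heps. destruct (Hder eps Heps) as [e He].
  assert (Hm : 0 < Rmin d e) by (apply Rmin_pos; apply cond_pos).
  assert (Hmd := Rmin_l d e). assert (Hme := Rmin_r d e).
  set (h := - (Rmin d e / 2)).
  assert (Hh : Rabs h = Rmin d e / 2) by (unfold h; rewrite Rabs_Ropp, Rabs_pos_eq; lra).
  assert (Hfh : f (x + h) = f x).
  { apply Hd; [|unfold h; lra]. change (Rabs (x + h - x) < d).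
    replace (x + h - x) with h by ring. lra. }
  specialize (He h ltac:(unfold h; lra) ltac:(lra)).
  rewrite Hfh, Rminus_diag, Rdiv_0_l, Rabs_minus_sym in He. exact He.
Qed.

Lemma eq_of_diff_multiple (x y k z : R) : z = 0 -> x - y = k * z -> x = y.
Proof. intros -> Hxy. lra. Qed.

Lemma exp_nondecreasing (x y : R) : x <= y -> exp x <= exp y.
Proof. intros [Hxy | ->]; [left; apply exp_increasing, Hxy | apply Rle_refl]. Qed.

Lemma young (w a b : R) : 0 < w -> Rabs (a * b) <= w * a ^ 2 / 2 + b ^ 2 / (2 * w).
Proof.
  intros Hw.
  assert (Hw2 : 0 < / (2 * w)) by (apply Rinv_0_lt_compat; lra).
  assert (Hsq : forall c, 0 <= (w * a + c) ^ 2 * / (2 * w))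
    by (intro c; apply Rmult_le_pos; [apply pow2_ge_0 | lra]).
  assert (Hplus := Hsq b). assert (Hminus := Hsq (- b)).
  replace ((w * a + b) ^ 2 * / (2 * w)) with (w * a ^ 2 / 2 + b ^ 2 / (2 * w) + a * b)
    in Hplus by (field; lra).
  replace ((w * a + - b) ^ 2 * / (2 * w)) with (w * a ^ 2 / 2 + b ^ 2 / (2 * w) - a * b)
    in Hminus by (field; lra).
  apply Rabs_le. lra.
Qed.

(** * Null coordinates *)

(* Null coordinates [eta = t + r] and [xi = t - r]; the tip of the cone is
   [eta = 0] and its boundary [xi = 0]. *)
Definition null {A : Type} (f : R -> R -> A) (eta xi : R) : A :=
  f ((eta + xi) / 2) ((eta - xi) / 2).

Lemma open2_null (W : R -> R -> Prop) : open2 W -> open2 (null W).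
Proof.
  intros HW. apply (open2_preimage W (fun x y => (x + y) / 2) (fun x y => (x - y) / 2) HW);
    intros x y; apply continuity_2d_pt_mult; try apply continuity_2d_pt_const.
  - apply continuity_2d_pt_plus; [apply continuity_2d_pt_id1 | apply continuity_2d_pt_id2].
  - apply continuity_2d_pt_minus; [apply continuity_2d_pt_id1 | apply continuity_2d_pt_id2].
Qed.

Lemma C1_on_null (W : R -> R -> Prop) f ft fr : open2 W -> C1_on W f ft fr ->
  C1_on (null W) (null f) (null (fun t r => (ft t r + fr t r) / 2))
    (null (fun t r => (ft t r - fr t r) / 2)).
Proof.
  intros HW Hf.
  assert (Hplus := C1_on_plus (null W) _ _ _ _ _ _ (C1_on_fst _) (C1_on_snd _)).
  assert (Hminus := C1_on_minus (null W) _ _ _ _ _ _ (C1_on_fst _) (C1_on_snd _)).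
  eapply (C1_on_ext_derive (null W) (open2_null W HW)).
  3: { eapply (C1_on_comp2 W HW (null W) f ft fr
         (fun x y => (x + y) / 2) _ _ (fun x y => (x - y) / 2)); [auto | exact Hf | C1_auto ..];
       intros x y _; lra. }
  - intros x y _. unfold null. field.
  - intros x y _. unfold null. field.
Qed.

Definition weight (mu xi1 eta xi : R) : R := exp (- mu * (xi / xi1 + xi1 / eta)).

Lemma weight_bounds mu xi1 eta xi : 0 < mu -> 0 < xi1 <= eta -> 0 <= xi <= xi1 ->
  exp (- (2 * mu)) <= weight mu xi1 eta xi <= 1.
Proof.
  intros Hmu Hxi1 Hxi.
  assert (Hx : 0 <= xi / xi1 <= 1) by (split; [apply Rdiv_le_0_compat | apply -> Rdiv_le_1]; lra).
  assert (He : 0 <= xi1 / eta <= 1) by (split; [apply Rdiv_le_0_compat | apply -> Rdiv_le_1]; lra).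
  unfold weight. rewrite <- exp_0. split; apply exp_nondecreasing; nra.
Qed.

(** * Equivariant Skyrme maps *)

Section Skyrme.

Variables (alpha T0 : R) (D : nat -> nat -> R -> R -> R) (U : R -> R -> Prop).
Hypothesis alpha_pos : 0 < alpha.
Hypothesis T0_pos : 0 < T0.
Hypothesis U_open : open2 U.
Hypothesis Omega_U : forall t r, Omega T0 t r -> U t r.
Hypothesis D_smooth : smooth_family U D.
Hypothesis pde : forall t r, 0 < t <= T0 -> 0 < r <= t -> skyrme_eq alpha D t r.
Hypothesis axis : forall t, 0 < t <= T0 -> D 0%nat 0%nat t 0 = 0.

Local Notation u := (D 0%nat 0%nat).
Local Notation ut := (D 1%nat 0%nat).
Local Notation ur := (D 0%nat 1%nat).
Local Notation utt := (D 2%nat 0%nat).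
Local Notation urr := (D 0%nat 2%nat).

Definition cone (t r : R) : Prop := 0 < t <= T0 /\ 0 < r <= t.

Local Notation domain := (radial_core U).

Lemma cone_in_domain t r : 0 < t <= T0 -> 0 <= r <= t -> domain t r.
Proof. intros Ht Hr s Hs. apply Omega_U. split; [exact Ht | nra]. Qed.

Lemma domain_open : open2 domain.
Proof. exact (open2_radial_core U U_open). Qed.

Lemma C1_on_D i j : C1_on U (D i j) (D (S i) j) (D i (S j)).
Proof.
  assert (Hcont : forall k l t r, U t r -> continuity_2d_pt (D k l) t r).
  { intros k l t r Htr eps. destruct (D_smooth k l t r Htr) as (_ & _ & Hc).
    destruct (Hc eps (cond_pos eps)) as [d [Hd Hball]].
    exists (mkposreal d Hd). exact Hball. }
  intros t r Htr. destruct (D_smooth i j t r Htr) as (Ht & Hr & _).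
  split; try apply is_derive_Reals; auto.
Qed.

Lemma C1_on_D_domain i j : C1_on domain (fun t r => D i j t r) (D (S i) j) (D i (S j)).
Proof. apply (C1_on_sub _ U); [apply radial_core_sub | apply C1_on_D]. Qed.

Lemma ut_axis t : 0 < t <= T0 -> ut t 0 = 0.
Proof.
  intros Ht. apply (is_derive_zero_of_left_constant (fun x => u x 0) t).
  - apply (C1_on_D 0 0 t 0), Omega_U. unfold Omega. lra.
  - exists (mkposreal t (proj1 Ht)). intros x Hx Hxt.
    change (Rabs (x - t) < t) in Hx. apply Rabs_def2 in Hx. rewrite !axis; lra.
Qed.

Definition slope : R -> R -> R := ray_moment 0 (fun t r => ur t r * cos (u t r)).

Lemma r_slope_domain t r : domain t r -> r * slope t r = sin (u t r) - sin (u t 0).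
Proof.
  apply (hadamard U (fun t r => sin (u t r)) (fun t r => ut t r * cos (u t r))).
  apply C1_on_sin, C1_on_D.
Qed.

Lemma r_slope t r : 0 < t <= T0 -> 0 <= r <= t -> r * slope t r = sin (u t r).
Proof.
  intros Ht Hr. rewrite r_slope_domain by (apply cone_in_domain; assumption).
  rewrite axis, sin_0 by exact Ht. ring.
Qed.

Lemma C1_on_slope : exists st sr, C1_on domain slope st sr /\
  forall t r, cone t r ->
    st t r = ut t r * cos (u t r) / r /\ sr t r = (ur t r * cos (u t r) - slope t r) / r.
Proof.
  assert (Hu := C1_on_D 0 0). assert (Hur := C1_on_D 0 1).
  assert (Hslope : exists st sr, C1_on domain slope st sr).
  { do 2 eexists. eapply (C1_on_ray_moment U U_open 0). C1_auto. }
  destruct Hslope as (st & sr & Hslope). exists st, sr. split; [exact Hslope|].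
  intros t r [Ht Hr].
  assert (Hud := C1_on_D_domain 0 0).
  assert (Hu0 : C1_on domain (fun t _ => u t 0) (fun t _ => ut t 0 * 1 + ur t 0 * 0)
    (fun t _ => ut t 0 * 0 + ur t 0 * 0)).
  { apply (C1_on_comp2 U U_open domain u ut ur (fun t _ => t) _ _ (fun _ _ => 0)); [| C1_auto ..].
    intros x y Hxy. rewrite <- (Rmult_0_l y). apply Hxy. lra. }
  assert (Hunique : exists ft fr gt gr,
    C1_on domain (fun t r => r * slope t r) ft fr /\
    C1_on domain (fun t r => sin (u t r) - sin (u t 0)) gt gr /\
    (r * st t r = ft t r /\ slope t r + r * sr t r = fr t r) /\
    (gt t r = ut t r * cos (u t r) /\ gr t r = ur t r * cos (u t r))).
  { do 4 eexists. split; [C1_auto|]. split; [C1_auto|]. split; [split; ring|].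
    simpl. rewrite ut_axis by exact Ht. split; ring. }
  destruct Hunique as (ft & fr & gt & gr & Hf & Hg & (Hft & Hfr) & Hgt & Hgr).
  destruct (C1_on_derive_unique domain domain_open _ ft fr _ gt gr t r
    r_slope_domain Hf Hg) as [Ht_eq Hr_eq]; [apply cone_in_domain; lra|].
  split; apply (Rmult_eq_reg_l r); try lra; field_simplify; lra.
Qed.

Definition F (t r : R) : R := 1 + alpha ^ 2 * slope t r ^ 2.

Lemma skyrme_eq_slope t r : cone t r ->
  r * F t r * (utt t r - urr t r) - (1 - alpha ^ 2 * slope t r ^ 2) * ur t r
  + slope t r * cos (u t r) * (alpha ^ 2 * (ut t r ^ 2 - ur t r ^ 2) + 1) = 0.
Proof.
  intros [Ht Hr]. assert (Hpde := pde t r Ht Hr).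
  unfold skyrme_eq in Hpde. cbv zeta in Hpde.
  rewrite sin_2a, <- (r_slope t r Ht) in Hpde by lra.
  apply (eq_of_diff_multiple _ _ r _ Hpde). unfold F. field. lra.
Qed.

Definition density (t r : R) : R :=
  r * (F t r * (ut t r ^ 2 + ur t r ^ 2) + slope t r ^ 2) / 2.

Definition flux (t r : R) : R := r * F t r * ut t r * ur t r.

Definition inflow (t r : R) : R := r * F t r * (ut t r + ur t r) ^ 2 / 2.

Definition outflow (t r : R) : R := r * F t r * (ut t r - ur t r) ^ 2 / 2.

Lemma density_plus_flux t r : density t r + flux t r = inflow t r + r * slope t r ^ 2 / 2.
Proof. unfold density, flux, inflow. field. Qed.

Lemma density_minus_flux t r : density t r - flux t r = outflow t r + r * slope t r ^ 2 / 2.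
Proof. unfold density, flux, outflow. field. Qed.

Lemma density_eq t r : 0 < t <= T0 -> 0 <= r <= t ->
  energy_density alpha D t r = density t r.
Proof.
  intros Ht Hr. unfold energy_density, density, F.
  destruct (Req_dec r 0) as [-> | Hr0]; [unfold Rdiv; ring|].
  rewrite <- (r_slope t r Ht Hr). field. exact Hr0.
Qed.

Ltac C1_solve := C1_auto; try apply C1_on_D_domain; try (intros ? ? _; lra).

Lemma energy_balance : balance domain cone density flux (fun _ _ => 0).
Proof.
  destruct C1_on_slope as (st & sr & Hslope & Hder).
  do 4 eexists. split; [unfold density, F; C1_solve|]. split; [unfold flux, F; C1_solve|].
  intros t r Htr. destruct (Hder t r Htr) as [Hst Hsr]. assert (Hpde := skyrme_eq_slope t r Htr).
  destruct Htr as [_ Hr]. simpl. rewrite Hst, Hsr.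
  apply (eq_of_diff_multiple _ _ (ut t r) _ Hpde). unfold F. field. lra.
Qed.

Lemma F_ge1 t r : 1 <= F t r.
Proof. unfold F. assert (0 <= (alpha * slope t r) ^ 2) by apply pow2_ge_0. lra. Qed.

Lemma inflow_ge0 t r : 0 <= r -> 0 <= inflow t r.
Proof.
  intros Hr. unfold inflow. assert (HF := F_ge1 t r).
  apply Rdiv_le_0_compat; [|lra].
  apply Rmult_le_pos; [apply Rmult_le_pos; lra | apply pow2_ge_0].
Qed.

Lemma outflow_ge0 t r : 0 <= r -> 0 <= outflow t r.
Proof.
  intros Hr. unfold outflow. assert (HF := F_ge1 t r).
  apply Rdiv_le_0_compat; [|lra].
  apply Rmult_le_pos; [apply Rmult_le_pos; lra | apply pow2_ge_0].
Qed.

Lemma density_ge0 t r : 0 <= r -> 0 <= density t r.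
Proof.
  intros Hr. unfold density. assert (HF := F_ge1 t r).
  assert (Ht2 := pow2_ge_0 (ut t r)). assert (Hr2 := pow2_ge_0 (ur t r)).
  assert (Hs2 := pow2_ge_0 (slope t r)).
  assert (0 <= F t r * (ut t r ^ 2 + ur t r ^ 2)) by (apply Rmult_le_pos; lra).
  apply Rmult_le_pos; [apply Rmult_le_pos|]; lra.
Qed.

Lemma density_ex_RInt t a b : 0 < t <= T0 -> 0 <= a -> a <= b -> b <= t ->
  ex_RInt (density t) a b.
Proof.
  intros Ht Ha Hab Hb. destruct energy_balance as (At & Ar & _ & _ & HA & _).
  apply (C1_on_slice_ex_RInt domain _ At Ar); [exact HA | exact Hab|].
  intros r Hr. apply cone_in_domain; lra.
Qed.

Definition energy (t : R) : R := RInt (density t) 0 t.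

Definition cone_flux (t : R) : R := density t t + flux t t.

Lemma balance_cone_slice A B C t : balance domain cone A B C -> 0 < t <= T0 ->
  ex_RInt (C t) 0 t /\
  is_derive (fun x => RInt (A x) 0 x) t (A t t + B t t - B t 0 + RInt (C t) 0 t).
Proof.
  intros Hbal Ht.
  destruct (balance_slice domain cone A B C (fun _ => 0) (fun x => x) 0 1 t
    domain_open Hbal) as [Hex Hder]; try lra.
  - apply (@is_derive_const R_AbsRing).
  - apply (@is_derive_id R_AbsRing).
  - intros r Hr. apply cone_in_domain; lra.
  - intros r Hr. split; lra.
  - split; [exact Hex|]. evar_last; [exact Hder | ring].
Qed.

Lemma energy_derive t : 0 < t <= T0 -> is_derive energy t (cone_flux t).
Proof.
  intros Ht. evar_last; [apply (balance_cone_slice _ _ _ t energy_balance Ht)|].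
  rewrite RInt_const. unfold cone_flux, flux, scal; simpl; unfold mult; simpl. ring.
Qed.

Lemma inflow_le_cone_flux t : 0 <= t -> inflow t t <= cone_flux t.
Proof.
  intros Ht. unfold cone_flux. rewrite density_plus_flux.
  assert (0 <= t * slope t t ^ 2) by (apply Rmult_le_pos; [exact Ht | apply pow2_ge_0]). lra.
Qed.

Lemma energy_mono s t : 0 < s -> s <= t -> t <= T0 -> energy s <= energy t.
Proof.
  intros Hs Hst Ht. apply nondecreasing_of_derive; [exact Hst|].
  intros x Hx. exists (cone_flux x). split; [apply energy_derive; lra|].
  apply Rle_trans with (inflow x x); [apply inflow_ge0 | apply inflow_le_cone_flux]; lra.
Qed.

Lemma energy_ge0 t : 0 < t <= T0 -> 0 <= energy t.
Proof.
  intros Ht. unfold energy. apply RInt_ge_0; [lra | apply density_ex_RInt; lra|].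
  intros r Hr. apply density_ge0. lra.
Qed.

Lemma energy_oscillation eps : 0 < eps ->
  exists d, 0 < d <= T0 /\ forall s t, 0 < s -> s <= t -> t <= d -> energy t - energy s <= eps.
Proof.
  intros Heps.
  exact (nondecreasing_oscillation energy 0 T0 eps T0_pos Heps energy_ge0 energy_mono).
Qed.

Lemma local_energy_le t a b : 0 < t <= T0 -> 0 <= a -> a <= b -> b <= t ->
  RInt (density t) a b <= energy T0.
Proof.
  intros Ht Ha Hab Hb. apply Rle_trans with (energy t); [|apply energy_mono; lra].
  unfold energy. apply RInt_subinterval_le; try lra; [apply density_ex_RInt; lra|].
  intros r Hr. apply density_ge0. lra.
Qed.

(** * Pointwise smallness near the tip *)

Definition tip_rate : R := energy T0 / alpha ^ 2 + / 4.

Lemma tip_rate_pos : 0 < tip_rate.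
Proof.
  unfold tip_rate. assert (Henergy := energy_ge0 T0 ltac:(lra)).
  assert (0 <= energy T0 / alpha ^ 2); [|lra].
  apply Rdiv_le_0_compat; [exact Henergy | apply pow_lt, alpha_pos].
Qed.

Lemma density_ge_quartic t r : 0 <= r ->
  alpha ^ 2 * (r * (slope t r * ur t r) ^ 2) / 2 <= density t r.
Proof.
  intros Hr. unfold density, F.
  assert (Hrest : 0 <= r * ((1 + alpha ^ 2 * slope t r ^ 2) * ut t r ^ 2 + ur t r ^ 2
    + slope t r ^ 2)).
  { apply Rmult_le_pos; [exact Hr|].
    assert (Hs2 := pow2_ge_0 (slope t r)). assert (Ht2 := pow2_ge_0 (ut t r)).
    assert (Hr2 := pow2_ge_0 (ur t r)).
    assert (0 <= (alpha * slope t r * ut t r) ^ 2) by apply pow2_ge_0. lra. }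
  lra.
Qed.

(* This use of the quartic term is what separates the model from wave maps, for
   which energy can concentrate. *)
Lemma ur_sin_le t r x : 0 < t <= T0 -> 0 < r -> 0 < x <= t ->
  ur t x * sin (u t x) <= r / alpha ^ 2 * density t x + x / (2 * r).
Proof.
  intros Ht Hr Hx. assert (Ha2 : 0 < alpha ^ 2) by (apply pow_lt, alpha_pos).
  rewrite <- (r_slope t x) by lra.
  assert (Hyoung := young r (slope t x * ur t x) 1 Hr).
  assert (Hquartic := density_ge_quartic t x ltac:(lra)).
  apply Rabs_le_between, proj2, (Rmult_le_compat_l x) in Hyoung; [|lra].
  apply (Rmult_le_compat_l (r / alpha ^ 2)) in Hquartic;
    [|apply Rlt_le, Rdiv_lt_0_compat; lra].
  replace (r / alpha ^ 2 * (alpha ^ 2 * (x * (slope t x * ur t x) ^ 2) / 2))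
    with (x * (r * (slope t x * ur t x) ^ 2 / 2)) in Hquartic by (field; lra).
  replace (x / (2 * r)) with (x * (1 ^ 2 / (2 * r))) by (field; lra). lra.
Qed.

Lemma one_minus_cos_le t r : 0 < t <= T0 -> 0 < r <= t -> 1 - cos (u t r) <= tip_rate * r.
Proof.
  intros Ht Hr. assert (Ha2 : 0 < alpha ^ 2) by (apply pow_lt, alpha_pos).
  assert (Hra : 0 < r / alpha ^ 2) by (apply Rdiv_lt_0_compat; lra).
  assert (Hcos : is_RInt (fun x => 0 - ur t x * - sin (u t x)) 0 r (1 - cos (u t r))).
  { assert (Hu := C1_on_D 0 0).
    assert (Hcos_C1 : exists ft, C1_on U (fun t r => 1 - cos (u t r)) ft
      (fun t r => 0 - ur t r * - sin (u t r))) by (eexists; C1_auto).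
    destruct Hcos_C1 as [ft Hcos_C1]. evar_last.
    - apply (C1_on_slice_FTC U (fun t r => 1 - cos (u t r)) ft
        (fun t r => 0 - ur t r * - sin (u t r)) t 0 r Hcos_C1); [lra|].
      intros x Hx. apply Omega_U. split; lra.
    - simpl. rewrite axis, cos_0 by exact Ht. ring. }
  assert (Hbound : is_RInt (fun x => r / alpha ^ 2 * density t x + x / (2 * r)) 0 r
    (r / alpha ^ 2 * RInt (density t) 0 r + r / 4)).
  { apply (@is_RInt_plus R_NormedModule).
    - apply (@is_RInt_scal R_NormedModule), (@RInt_correct R_CompleteNormedModule).
      apply density_ex_RInt; lra.
    - evar_last.
      + apply (@is_RInt_derive R_CompleteNormedModule (fun x => x ^ 2 / (4 * r)));
          intros x _; [auto_derive; [auto | field; lra]|].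
        apply (@ex_derive_continuous R_AbsRing R_NormedModule). auto_derive. lra.
      + unfold minus, plus, opp; simpl. field. lra. }
  assert (Hlocal := local_energy_le t 0 r Ht (Rle_refl 0) ltac:(lra) (proj2 Hr)).
  apply (Rmult_le_compat_l (r / alpha ^ 2)) in Hlocal; [|lra].
  unfold tip_rate.
  replace ((energy T0 / alpha ^ 2 + / 4) * r) with (r / alpha ^ 2 * energy T0 + r / 4)
    by (field; lra).
  apply Rle_trans with (r / alpha ^ 2 * RInt (density t) 0 r + r / 4); [|lra].
  apply (is_RInt_le _ _ 0 r _ _ (Rlt_le _ _ (proj1 Hr)) Hcos Hbound). intros x Hx.
  assert (Hpoint := ur_sin_le t r x Ht (proj1 Hr)). lra.
Qed.

Lemma r_slope_sqr_le t r : 0 < t <= T0 -> 0 < r <= t -> r * slope t r ^ 2 <= 2 * tip_rate.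
Proof.
  intros Ht Hr. assert (Hcos := one_minus_cos_le t r Ht Hr).
  assert (Hbound := COS_bound (u t r)). assert (Htrig := sin2_cos2 (u t r)). unfold Rsqr in Htrig.
  apply (Rmult_le_reg_l r); [lra|].
  replace (r * (r * slope t r ^ 2)) with ((r * slope t r) ^ 2) by ring.
  rewrite r_slope by lra. nra.
Qed.

Definition sinF_bound : R := 2 * tip_rate * T0 + 4 * alpha ^ 2 * tip_rate ^ 2.

Lemma sinF_bound_pos : 0 < sinF_bound.
Proof.
  assert (Hrate := tip_rate_pos). unfold sinF_bound.
  assert (0 < tip_rate * T0) by (apply Rmult_lt_0_compat; lra).
  assert (0 <= (alpha * tip_rate) ^ 2) by apply pow2_ge_0. lra.
Qed.

Lemma r2_F_slope_sqr_le t r : 0 < t <= T0 -> 0 < r <= t ->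
  r ^ 2 * F t r * slope t r ^ 2 <= sinF_bound.
Proof.
  intros Ht Hr. assert (Hs := r_slope_sqr_le t r Ht Hr). assert (Hrate := tip_rate_pos).
  set (z := r * slope t r ^ 2) in *.
  assert (Hz : 0 <= z) by (apply Rmult_le_pos; [lra | apply pow2_ge_0]).
  replace (r ^ 2 * F t r * slope t r ^ 2) with (r * z + alpha ^ 2 * z ^ 2)
    by (unfold F, z; ring).
  unfold sinF_bound. apply Rplus_le_compat.
  - rewrite (Rmult_comm _ T0). apply Rmult_le_compat; lra.
  - replace (4 * alpha ^ 2 * tip_rate ^ 2) with (alpha ^ 2 * (2 * tip_rate) ^ 2) by ring.
    apply Rmult_le_compat_l; [apply pow2_ge_0 | apply pow_incr; lra].
Qed.

(** * Decay in the exterior region *)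

Definition null_form (t r : R) : R :=
  (1 - alpha ^ 2 * slope t r ^ 2) * ((ut t r + ur t r) * (ut t r - ur t r)).

Lemma null_transport : exists it ir ot ou,
  C1_on domain inflow it ir /\ C1_on domain outflow ot ou /\
  forall t r, cone t r ->
    it t r - ir t r =
      - null_form t r / 2 - slope t r * cos (u t r) * (ut t r + ur t r) /\
    ot t r + ou t r =
      null_form t r / 2 - slope t r * cos (u t r) * (ut t r - ur t r).
Proof.
  destruct C1_on_slope as (st & sr & Hslope & Hder).
  do 4 eexists. split; [unfold inflow, F; C1_solve|]. split; [unfold outflow, F; C1_solve|].
  intros t r Htr. destruct (Hder t r Htr) as [Hst Hsr]. assert (Hpde := skyrme_eq_slope t r Htr).
  destruct Htr as [_ Hr]. simpl. rewrite Hst, Hsr. split.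
  - apply (eq_of_diff_multiple _ _ (ut t r + ur t r) _ Hpde). unfold F, null_form. field. lra.
  - apply (eq_of_diff_multiple _ _ (ut t r - ur t r) _ Hpde). unfold F, null_form. field. lra.
Qed.

Lemma null_cone eta xi : 0 <= xi < eta -> eta + xi <= 2 * T0 -> null cone eta xi.
Proof. intros Hxi Heta. unfold null, cone. lra. Qed.

Lemma null_in_domain eta xi : 0 <= xi < eta -> eta + xi <= 2 * T0 -> null domain eta xi.
Proof. intros Hxi Heta. apply cone_in_domain; lra. Qed.

Definition coupling (t r : R) : R :=
  (null_form t r - slope t r * cos (u t r) * (ut t r - ur t r)
   + slope t r * cos (u t r) * (ut t r + ur t r)) / 2.

Definition weighted_source (mu xi1 eta xi : R) : R :=
  weight mu xi1 eta xi *
    (mu * (xi1 / eta ^ 2 * null outflow eta xi + / xi1 * null inflow eta xi)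
     + null coupling eta xi).

Lemma weighted_null_balance (mu xi1 : R) : 0 < xi1 ->
  balance (fun eta xi => 0 < eta /\ null domain eta xi) (null cone)
    (fun eta xi => weight mu xi1 eta xi * null outflow eta xi)
    (fun eta xi => weight mu xi1 eta xi * null inflow eta xi)
    (weighted_source mu xi1).
Proof.
  intros Hxi1. destruct null_transport as (it & ir & ot & ou & Hin & Hout & Htr).
  set (V := fun eta xi => 0 < eta /\ null domain eta xi).
  assert (HV : forall x y, V x y -> null domain x y) by (intros x y [_ Hxy]; exact Hxy).
  apply (C1_on_null _ _ _ _ domain_open), (C1_on_sub V _ _ _ _ HV) in Hin.
  apply (C1_on_null _ _ _ _ domain_open), (C1_on_sub V _ _ _ _ HV) in Hout.
  do 4 eexists. split; [unfold weight; C1_auto; intros x y [Hx _]; lra|].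
  split; [unfold weight; C1_auto; intros x y [Hx _]; lra|].
  intros x y Hxy. destruct (Htr _ _ Hxy) as [Hinflow Houtflow].
  assert (Hx : 0 < x) by (destruct Hxy; lra).
  unfold weighted_source, null, coupling in *. rewrite Hinflow, Houtflow.
  unfold weight. field. lra.
Qed.

Lemma null_form_le (g eta xi1 t r : R) :
  0 < g -> 0 < eta -> 0 < xi1 -> g * eta / 2 <= r ->
  Rabs (null_form t r) <= 2 * (/ g * (xi1 / eta ^ 2 * outflow t r + / xi1 * inflow t r)).
Proof.
  intros Hg Heta Hxi1 Hr. assert (HF := F_ge1 t r).
  assert (Hge : 0 < g * eta / 2) by (apply Rdiv_lt_0_compat; [apply Rmult_lt_0_compat |]; lra).
  assert (Ha : 0 < xi1 / eta) by (apply Rdiv_lt_0_compat; lra).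
  assert (Hcoef : Rabs (1 - alpha ^ 2 * slope t r ^ 2) <= F t r)
    by (unfold F; apply Rabs_le; assert (Hsqr := pow2_ge_0 (alpha * slope t r)); lra).
  assert (Hyoung := young (xi1 / eta) (ut t r - ur t r) (ut t r + ur t r) Ha).
  rewrite Rmult_comm in Hyoung.
  apply (Rmult_le_reg_l (g * eta / 2)); [exact Hge|].
  apply Rle_trans with (r * Rabs (null_form t r));
    [apply Rmult_le_compat_r; [apply Rabs_pos | exact Hr]|].
  replace (g * eta / 2 * (2 * (/ g * (xi1 / eta ^ 2 * outflow t r + / xi1 * inflow t r)))) with
    (r * (F t r * (xi1 / eta * (ut t r - ur t r) ^ 2 / 2
      + (ut t r + ur t r) ^ 2 / (2 * (xi1 / eta)))))
    by (unfold outflow, inflow; field; lra).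
  unfold null_form. rewrite Rabs_mult. apply Rmult_le_compat_l; [lra|].
  apply Rmult_le_compat; [apply Rabs_pos | apply Rabs_pos | exact Hcoef | exact Hyoung].
Qed.

Lemma slope_cos_le t r z a : 0 < t <= T0 -> 0 < r <= t -> 0 < a ->
  Rabs (slope t r * cos (u t r) * z) <= a * (r * F t r * z ^ 2 / 2) + tip_rate / (a * r ^ 2).
Proof.
  intros Ht Hr Ha. assert (Hs := r_slope_sqr_le t r Ht Hr).
  assert (HF := F_ge1 t r). assert (Har : 0 < a * r) by (apply Rmult_lt_0_compat; lra).
  assert (Hyoung := young (a * r) z (slope t r) Har).
  apply Rle_trans with (Rabs (z * slope t r)).
  { replace (slope t r * cos (u t r) * z) with (z * slope t r * cos (u t r)) by ring.
    rewrite Rabs_mult. rewrite <- (Rmult_1_r (Rabs (z * slope t r))) at 2.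
    apply Rmult_le_compat_l; [apply Rabs_pos | apply Rabs_le, COS_bound]. }
  apply (Rle_trans _ _ _ Hyoung), Rplus_le_compat.
  - replace (a * (r * F t r * z ^ 2 / 2)) with (a * r * z ^ 2 / 2 * F t r) by field.
    rewrite <- (Rmult_1_r (a * r * z ^ 2 / 2)) at 1. apply Rmult_le_compat_l; [|exact HF].
    apply Rdiv_le_0_compat; [apply Rmult_le_pos; [lra | apply pow2_ge_0] | lra].
  - replace (slope t r ^ 2 / (2 * (a * r))) with (r * slope t r ^ 2 * / (2 * a * r ^ 2))
      by (field; lra).
    replace (tip_rate / (a * r ^ 2)) with (2 * tip_rate * / (2 * a * r ^ 2)) by (field; lra).
    apply Rmult_le_compat_r; [|exact Hs].
    apply Rlt_le, Rinv_0_lt_compat, Rmult_lt_0_compat; [lra | apply pow_lt; lra].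
Qed.

(* The derivative of the weight, which is monotone along both null directions,
   absorbs the coupling of the transport equations. *)
Lemma null_source_ge (g eta xi1 t r : R) :
  0 < g -> 0 < xi1 <= eta -> g * eta / 2 <= r -> cone t r ->
  - (4 * tip_rate / (g ^ 2 * xi1)) <=
    (1 + / g) * (xi1 / eta ^ 2 * outflow t r + / xi1 * inflow t r) + coupling t r.
Proof.
  intros Hg Hxi1 Hger [Ht Hr]. assert (Hrate := tip_rate_pos).
  assert (Hge : 0 < g * eta) by (apply Rmult_lt_0_compat; lra).
  set (a := xi1 / eta ^ 2). set (b := / xi1).
  assert (Ha : 0 < a) by (apply Rdiv_lt_0_compat; [lra | apply pow_lt; lra]).
  assert (Hb : 0 < b) by (apply Rinv_0_lt_compat; lra).
  assert (Hab : a <= b).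
  { replace a with (b * (xi1 / eta) ^ 2) by (unfold a, b; field; lra).
    rewrite <- (Rmult_1_r b) at 2. apply Rmult_le_compat_l; [lra|].
    rewrite <- (pow1 2). apply pow_incr.
    split; [apply Rdiv_le_0_compat | apply -> Rdiv_le_1]; lra. }
  assert (Hremainder : forall w, a <= w -> tip_rate / (w * r ^ 2) <= 4 * tip_rate / (g ^ 2 * xi1)).
  { intros w Hw. assert (Hr2 : (g * eta / 2) ^ 2 <= r ^ 2) by (apply pow_incr; lra).
    assert (Hr2pos : 0 < (g * eta / 2) ^ 2) by (apply pow_lt; lra).
    replace (4 * tip_rate / (g ^ 2 * xi1)) with (tip_rate / (a * (g * eta / 2) ^ 2))
      by (unfold a; field; lra).
    apply Rmult_le_compat_l; [lra|].
    apply Rinv_le_contravar; [apply Rmult_lt_0_compat | apply Rmult_le_compat]; lra. }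
  assert (Hq := slope_cos_le t r (ut t r - ur t r) a Ht Hr Ha).
  assert (Hp := slope_cos_le t r (ut t r + ur t r) b Ht Hr Hb).
  fold (outflow t r) in Hq. fold (inflow t r) in Hp.
  assert (Hqr := Hremainder a (Rle_refl a)). assert (Hpr := Hremainder b Hab).
  assert (Hform := null_form_le g eta xi1 t r Hg ltac:(lra) (proj1 Hxi1) Hger). fold a b in Hform.
  assert (Hpos : 0 <= a * outflow t r + b * inflow t r)
    by (apply Rplus_le_le_0_compat; apply Rmult_le_pos;
        try apply outflow_ge0; try apply inflow_ge0; lra).
  apply Rabs_le_between in Hform. apply Rabs_le_between in Hq. apply Rabs_le_between in Hp.
  unfold coupling. lra.
Qed.

Lemma null_outflow_C1 : exists ft fr, C1_on (null domain) (null outflow) ft fr.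
Proof.
  destruct null_transport as (_ & _ & ot & ou & _ & Hout & _).
  do 2 eexists. exact (C1_on_null _ _ _ _ domain_open Hout).
Qed.

Lemma null_outflow_ex_RInt eta b : 0 <= b < eta -> eta <= T0 ->
  ex_RInt (null outflow eta) 0 b.
Proof.
  intros Hb Heta. destruct null_outflow_C1 as (ft & fr & Hout).
  apply (C1_on_slice_ex_RInt (null domain) _ ft fr); [exact Hout | lra|].
  intros xi Hxi. apply null_in_domain; lra.
Qed.

Definition weighted_outflow (mu xi1 eta : R) : R :=
  RInt (fun xi => weight mu xi1 eta xi * null outflow eta xi) 0 xi1.

Lemma weighted_outflow_ex_RInt (mu xi1 eta : R) : 0 < xi1 < eta -> eta <= T0 ->
  ex_RInt (fun xi => weight mu xi1 eta xi * null outflow eta xi) 0 xi1.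
Proof.
  intros Hxi1 Heta.
  destruct (weighted_null_balance mu xi1 (proj1 Hxi1)) as (At & Ar & _ & _ & HA & _).
  apply (C1_on_slice_ex_RInt (fun eta xi => 0 < eta /\ null domain eta xi)
    (fun eta xi => weight mu xi1 eta xi * null outflow eta xi) At Ar); [exact HA | lra|].
  intros xi Hxi. split; [lra | apply null_in_domain; lra].
Qed.

Lemma weighted_source_RInt_ge (kap xi1 eta : R) :
  0 < kap < 1 -> 0 < xi1 <= kap * eta -> eta <= T0 ->
  ex_RInt (weighted_source (1 + / (1 - kap)) xi1 eta) 0 xi1 ->
  - (4 * tip_rate / (1 - kap) ^ 2) <= RInt (weighted_source (1 + / (1 - kap)) xi1 eta) 0 xi1.
Proof.
  intros Hkap Hxi1 HetaT Hex. assert (Hrate := tip_rate_pos).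
  assert (Heta : xi1 < eta) by nra.
  set (mu := 1 + / (1 - kap)) in *.
  assert (Hmu : 0 < mu)
    by (apply Rplus_lt_0_compat; [lra | apply Rinv_0_lt_compat; lra]).
  set (loss := 4 * tip_rate / ((1 - kap) ^ 2 * xi1)).
  assert (Hloss : 0 <= loss).
  { apply Rdiv_le_0_compat; [lra | apply Rmult_lt_0_compat; [apply pow_lt|]; lra]. }
  replace (- (4 * tip_rate / (1 - kap) ^ 2))
    with (0 * RInt (weighted_source mu xi1 eta) 0 xi1 + - loss * (xi1 - 0))
    by (unfold loss; field; lra).
  apply RInt_ge_affine; try assumption; try lra. intros xi Hxi.
  assert (Hbound := null_source_ge (1 - kap) eta xi1 ((eta + xi) / 2) ((eta - xi) / 2)
    ltac:(lra) ltac:(lra) ltac:(nra) (null_cone eta xi ltac:(lra) ltac:(lra))).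
  fold loss mu in Hbound.
  assert (Hw1 : weight mu xi1 eta xi <= 1) by (apply weight_bounds; lra).
  assert (Hw0 : 0 < weight mu xi1 eta xi) by apply exp_pos.
  apply Rle_trans with (weight mu xi1 eta xi * - loss); [nra|].
  apply Rmult_le_compat_l; [lra | exact Hbound].
Qed.

Lemma weighted_outflow_derive (kap xi1 eta : R) :
  0 < kap < 1 -> 0 < xi1 <= kap * eta -> eta <= T0 ->
  exists d, is_derive (weighted_outflow (1 + / (1 - kap)) xi1) eta d /\
    - cone_flux (eta / 2) - 4 * tip_rate / (1 - kap) ^ 2 <= d.
Proof.
  intros Hkap Hxi1 HetaT. assert (Heta : xi1 < eta) by nra.
  set (mu := 1 + / (1 - kap)).
  assert (Hmu : 0 < mu)
    by (apply Rplus_lt_0_compat; [lra | apply Rinv_0_lt_compat; lra]).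
  destruct (balance_slice _ _ _ _ _ (fun _ => 0) (fun _ => xi1) 0 0 eta
    (open2_and _ _ open2_half_plane_fst (open2_null _ domain_open))
    (weighted_null_balance mu xi1 (proj1 Hxi1))) as [Hex Hder].
  { apply (@is_derive_const R_AbsRing). }
  { apply (@is_derive_const R_AbsRing). }
  { lra. }
  { intros xi Hxi. split; [lra | apply null_in_domain; lra]. }
  { intros xi Hxi. apply null_cone; lra. }
  eexists. split; [exact Hder|].
  assert (Hsource := weighted_source_RInt_ge kap xi1 eta Hkap Hxi1 HetaT Hex). fold mu in Hsource.
  assert (Hend : 0 <= weight mu xi1 eta xi1 * null inflow eta xi1).
  { apply Rmult_le_pos; [apply Rlt_le, exp_pos | apply inflow_ge0; lra]. }
  assert (Htip : weight mu xi1 eta 0 * null inflow eta 0 <= cone_flux (eta / 2)).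
  { apply Rle_trans with (1 * inflow (eta / 2) (eta / 2)).
    - unfold null. rewrite Rplus_0_r, Rminus_0_r.
      apply Rmult_le_compat_r; [apply inflow_ge0 | apply weight_bounds]; lra.
    - rewrite Rmult_1_l. apply inflow_le_cone_flux. lra. }
  lra.
Qed.

Lemma null_outflow_propagation (kap xi1 eta eta0 : R) :
  0 < kap < 1 -> 0 < xi1 <= kap * eta -> eta <= eta0 <= T0 ->
  exp (- (2 * (1 + / (1 - kap)))) * RInt (null outflow eta) 0 xi1
    <= RInt (null outflow eta0) 0 xi1 + 2 * (energy (eta0 / 2) - energy (eta / 2))
       + 4 * tip_rate / (1 - kap) ^ 2 * (eta0 - eta).
Proof.
  intros Hkap Hxi1 Heta0. set (mu := 1 + / (1 - kap)). set (C := 4 * tip_rate / (1 - kap) ^ 2).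
  assert (Hmu : 0 < mu)
    by (apply Rplus_lt_0_compat; [lra | apply Rinv_0_lt_compat; lra]).
  assert (Heta : xi1 < eta) by nra.
  assert (Hmono : weighted_outflow mu xi1 eta + 2 * energy (eta / 2) + C * eta
    <= weighted_outflow mu xi1 eta0 + 2 * energy (eta0 / 2) + C * eta0).
  { apply (nondecreasing_of_derive
      (fun x => weighted_outflow mu xi1 x + 2 * energy (x / 2) + C * x)); [lra|].
    intros x Hx.
    destruct (weighted_outflow_derive kap xi1 x Hkap) as [d [Hd Hdge]]; [nra | lra|].
    exists (d + 2 * (/ 2 * cone_flux (x / 2)) + C). split; [|unfold C; lra].
    apply (@is_derive_plus R_AbsRing R_NormedModule);
      [apply (@is_derive_plus R_AbsRing R_NormedModule); [exact Hd|] |].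
    - apply is_derive_scal, (is_derive_comp energy (fun y => y / 2));
        [apply energy_derive; lra | auto_derive; [auto | field]].
    - auto_derive; [auto | ring]. }
  assert (Hw_ex : forall x, eta <= x <= T0 ->
    ex_RInt (fun xi => weight mu xi1 x xi * null outflow x xi) 0 xi1)
    by (intros x Hx; apply weighted_outflow_ex_RInt; lra).
  assert (Hlow : exp (- (2 * mu)) * RInt (null outflow eta) 0 xi1 <= weighted_outflow mu xi1 eta).
  { replace (exp (- (2 * mu)) * RInt (null outflow eta) 0 xi1)
      with (exp (- (2 * mu)) * RInt (null outflow eta) 0 xi1 + 0 * (xi1 - 0)) by ring.
    apply RInt_ge_affine; [lra | apply Hw_ex; lra | apply null_outflow_ex_RInt; lra|].
    intros xi Hxi. rewrite Rplus_0_r. apply Rmult_le_compat_r; [apply outflow_ge0; lra|].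
    apply weight_bounds; lra. }
  assert (Hup : weighted_outflow mu xi1 eta0 <= RInt (null outflow eta0) 0 xi1).
  { apply RInt_le; [lra | apply Hw_ex; lra | apply null_outflow_ex_RInt; lra|].
    intros xi Hxi. rewrite <- (Rmult_1_l (null outflow eta0 xi)) at 2.
    apply Rmult_le_compat_r; [apply outflow_ge0; lra | apply weight_bounds; lra]. }
  lra.
Qed.

Lemma null_outflow_RInt_derive eta b : 0 <= b < eta -> eta <= T0 ->
  is_derive (fun x => RInt (null outflow eta) 0 x) b (null outflow eta b).
Proof.
  intros Hb Heta. destruct null_outflow_C1 as (ft & fr & Hout).
  assert (Hseg : forall xi, 0 <= xi <= b -> null domain eta xi)
    by (intros xi Hxi; apply null_in_domain; lra).
  apply (C1_on_slice_RInt_derive (null domain) (null outflow) ft fr eta 0 b);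
    [apply open2_null, domain_open | exact Hout | exact (proj1 Hb) | exact Hseg].
Qed.

Lemma null_outflow_RInt_small kap eta eps : 0 < kap -> 0 < eta <= T0 -> 0 < eps ->
  at_right 0 (fun x => RInt (null outflow eta) 0 (kap * x) <= eps).
Proof.
  intros Hkap Heta Heps.
  apply (at_right_0_scale kap (fun x => RInt (null outflow eta) 0 x <= eps) Hkap).
  apply filter_le_within.
  assert (Hcont : continuous (fun x => RInt (null outflow eta) 0 x) 0).
  { apply (@ex_derive_continuous R_AbsRing R_NormedModule). eexists.
    apply null_outflow_RInt_derive; lra. }
  assert (Hnear := proj1 (filterlim_locally _ _) Hcont (mkposreal eps Heps)).
  apply (filter_imp _ _) with (2 := Hnear). intros x Hx.
  rewrite RInt_point in Hx. change (Rabs (RInt (null outflow eta) 0 x - 0) < eps) in Hx.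
  apply Rabs_def2 in Hx. lra.
Qed.

Lemma null_outflow_decay kap eps : 0 < kap < 1 -> 0 < eps ->
  at_right 0 (fun eta => RInt (null outflow eta) 0 (kap * eta) <= eps).
Proof.
  intros Hkap Heps.
  set (low := exp (- (2 * (1 + / (1 - kap))))). set (C := 4 * tip_rate / (1 - kap) ^ 2).
  assert (Hlow : 0 < low) by apply exp_pos.
  assert (Hrate := tip_rate_pos).
  assert (HC : 0 < C) by (apply Rdiv_lt_0_compat; [|apply pow_lt]; lra).
  set (eps' := low * eps / 4).
  assert (Heps' : 0 < eps')
    by (apply Rdiv_lt_0_compat; [apply Rmult_lt_0_compat; assumption | lra]).
  destruct (energy_oscillation eps' Heps') as [d [Hd Hosc]].
  set (eta0 := Rmin d (eps' / C)).
  assert (Heta0 : 0 < eta0) by (apply Rmin_pos; [lra | apply Rdiv_lt_0_compat; assumption]).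
  assert (Heta0_d : eta0 <= d) by apply Rmin_l.
  assert (HCeta0 : C * eta0 <= eps').
  { replace eps' with (C * (eps' / C)) by (field; lra).
    apply Rmult_le_compat_l; [lra | apply Rmin_r]. }
  apply (filter_imp _ _) with (2 := filter_and _ _ (at_right_0_interval eta0 Heta0)
    (null_outflow_RInt_small kap eta0 eps' (proj1 Hkap) ltac:(lra) Heps')).
  intros eta [Heta Hsmall].
  assert (Hprop := null_outflow_propagation kap (kap * eta) eta eta0 Hkap). fold low C in Hprop.
  assert (HE := Hosc (eta / 2) (eta0 / 2) ltac:(lra) ltac:(lra) ltac:(lra)).
  assert (0 < C * eta) by (apply Rmult_lt_0_compat; lra).
  assert (0 < kap * eta) by (apply Rmult_lt_0_compat; lra).
  apply (Rmult_le_reg_l low); [exact Hlow|].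
  apply Rle_trans with (4 * eps'); [|right; unfold eps'; field].
  apply (Rle_trans _ _ _ (Hprop ltac:(lra) ltac:(lra))). lra.
Qed.

(* Conservation of energy on the region bounded by the slice [t = T], the cone
   and the backward null line [t + r = eta]. *)
Lemma exterior_energy_le eta T : 0 < T <= T0 -> T < eta < 2 * T -> eta <= T0 ->
  RInt (density T) (eta - T) T
    <= energy T - energy (eta / 2) + RInt (null outflow eta) 0 (2 * T - eta) / 2 + tip_rate * T.
Proof.
  intros HT Heta HetaT. assert (Hrate := tip_rate_pos).
  set (Y := fun x => RInt (null outflow eta) 0 x : R).
  assert (Hmono : energy (eta / 2) + / 2 * Y (2 * (eta / 2) - eta) + tip_rate * (eta / 2)
      - RInt (density (eta / 2)) (eta - eta / 2) (eta / 2)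
    <= energy T + / 2 * Y (2 * T - eta) + tip_rate * T - RInt (density T) (eta - T) T).
  { apply (nondecreasing_of_derive (fun x =>
      energy x + / 2 * Y (2 * x - eta) + tip_rate * x - RInt (density x) (eta - x) x)); [lra|].
    intros x Hx.
    destruct (balance_slice domain cone density flux _ (fun x => eta - x) (fun x => x)
      (- 1) 1 x domain_open energy_balance) as [_ Hslice]; try lra.
    { auto_derive; [auto | ring]. }
    { apply (@is_derive_id R_AbsRing). }
    { intros r Hr. apply cone_in_domain; lra. }
    { intros r Hr. split; lra. }
    eexists. split.
    - apply (@is_derive_minus R_AbsRing R_NormedModule); [|exact Hslice].
      apply (@is_derive_plus R_AbsRing R_NormedModule);
        [apply (@is_derive_plus R_AbsRing R_NormedModule); [apply energy_derive; lra|] |].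
      + apply is_derive_scal, (is_derive_comp Y (fun x => 2 * x - eta));
          [apply null_outflow_RInt_derive; lra | auto_derive; [auto | reflexivity]].
      + auto_derive; [auto | reflexivity].
    - assert (Hs := r_slope_sqr_le x (eta - x) ltac:(lra) ltac:(lra)).
      assert (Hline := density_minus_flux x (eta - x)).
      replace (null outflow eta (2 * x - eta)) with (outflow x (eta - x))
        by (unfold null; f_equal; field).
      rewrite RInt_const. unfold cone_flux, minus, plus, opp, scal; simpl.
      unfold mult; simpl. lra. }
  replace (eta - eta / 2) with (eta / 2) in Hmono by field.
  replace (2 * (eta / 2) - eta) with 0 in Hmono by field.
  unfold Y in *. rewrite !RInt_point in Hmono.
  change (@zero R_CompleteNormedModule) with 0 in Hmono.
  assert (0 <= tip_rate * (eta / 2)) by (apply Rmult_le_pos; lra). lra.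
Qed.

Lemma exterior_decay lam eps : 0 < lam < 1 -> 0 < eps ->
  at_right 0 (fun T => RInt (density T) (lam * T) T <= eps).
Proof.
  intros Hlam Heps. assert (Hrate := tip_rate_pos).
  set (kap := (1 - lam) / (1 + lam)).
  assert (Hkap : 0 < kap < 1).
  { unfold kap. split; [apply Rdiv_lt_0_compat; lra|].
    apply (Rmult_lt_reg_r (1 + lam)); [lra|]. field_simplify; lra. }
  assert (Heps3 : 0 < eps / 3) by lra.
  destruct (energy_oscillation (eps / 3) Heps3) as [d [Hd Hosc]].
  assert (Hout := at_right_0_scale (1 + lam) _ ltac:(lra)
    (null_outflow_decay kap (eps / 3) Hkap Heps3)).
  assert (Hd2 : 0 < d / 2) by lra.
  assert (Hratio : 0 < eps / (3 * tip_rate)) by (apply Rdiv_lt_0_compat; lra).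
  apply (filter_imp _ _) with (2 := filter_and _ _ Hout
    (filter_and _ _ (at_right_0_interval _ Hd2) (at_right_0_interval _ Hratio))).
  intros T [Houtflow [HTd HTrate]].
  assert (HlamT : 0 < lam * T < T) by nra.
  assert (Hext := exterior_energy_le ((1 + lam) * T) T).
  replace ((1 + lam) * T - T) with (lam * T) in Hext by ring.
  replace (2 * T - (1 + lam) * T) with (kap * ((1 + lam) * T)) in Hext
    by (unfold kap; field; lra).
  assert (HE := Hosc ((1 + lam) * T / 2) T ltac:(lra) ltac:(lra) ltac:(lra)).
  assert (HrateT : tip_rate * T <= eps / 3).
  { replace (eps / 3) with (tip_rate * (eps / (3 * tip_rate))) by (field; lra).
    apply Rmult_le_compat_l; lra. }
  specialize (Hext ltac:(lra) ltac:(lra) ltac:(lra)). lra.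
Qed.

(** * Morawetz estimate *)

Definition morawetz (t r : R) : R :=
  r ^ 2 * ut t r * ((F t r - 4) * slope t r - 9 * F t r * ur t r).

Definition morawetz_flux (t r : R) : R :=
  r ^ 2 * ((F t r - 4) * slope t r * ur t r
           - 9 * (F t r * (ut t r ^ 2 + ur t r ^ 2) - slope t r ^ 2) / 2).

Definition morawetz_source (t r : R) : R :=
  r * (9 * (ut t r ^ 2 + alpha ^ 2 * slope t r ^ 2 * ur t r ^ 2)
       - 4 * (cos (u t r) * (ut t r ^ 2 - ur t r ^ 2 - slope t r ^ 2)
              - 2 * (alpha ^ 2 * slope t r ^ 2) * (slope t r * ur t r)) / F t r
       + cos (u t r) * ((ut t r ^ 2 - ur t r ^ 2) * (1 + 2 * (alpha ^ 2 * slope t r ^ 2))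
                        - slope t r ^ 2)).

(* The multiplier is [-9 r u_r - 4 sin u / F + sin u]: the first term gives a
   virial identity whose source [r u_t^2 + alpha^2 sin^2 u u_r^2 / r] has a sign,
   the second then controls [r u_r^2] and the third [alpha^2 sin^2 u u_t^2 / r]. *)
Lemma morawetz_balance : balance domain cone morawetz morawetz_flux morawetz_source.
Proof.
  destruct C1_on_slope as (st & sr & Hslope & Hder).
  do 4 eexists. split; [unfold morawetz, F; C1_solve|].
  split; [unfold morawetz_flux, F; C1_solve|].
  intros t r Htr. destruct (Hder t r Htr) as [Hst Hsr]. assert (Hpde := skyrme_eq_slope t r Htr).
  assert (HF := F_ge1 t r). destruct Htr as [_ Hr]. simpl. rewrite Hst, Hsr.
  apply (eq_of_diff_multiple _ _
    (-9 * r * ur t r - 4 * (r * slope t r) / F t r + r * slope t r) _ Hpde).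
  unfold morawetz_source, F in *. field. lra.
Qed.

(* [k] stands for [1 / F] and [Y] for [F - 1]. *)
Lemma morawetz_source_algebra (Y k s c a b : R) :
  0 <= Y -> k * (1 + Y) = 1 -> / 2 <= c <= 1 ->
  (1 + Y) * (a ^ 2 + b ^ 2) - 3 * s ^ 2 <=
    9 * (a ^ 2 + Y * b ^ 2) - 4 * (c * (a ^ 2 - b ^ 2 - s ^ 2) - 2 * Y * (s * b)) * k
    + c * ((a ^ 2 - b ^ 2) * (1 + 2 * Y) - s ^ 2).
Proof.
  intros HY Hk Hc.
  assert (Hk0 : 0 <= k) by nra.
  assert (HYk : k * Y = 1 - k) by lra.
  assert (Hk1 : k <= 1) by nra.
  assert (HkY : 1 - Y <= k) by nra.
  assert (Hcross : - (2 * Y * b ^ 2) - 2 * s ^ 2 <= 8 * Y * (s * b) * k).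
  { assert (Hsquare : 0 <= 2 * Y * (b + 2 * (k * s)) ^ 2)
      by (apply Rmult_le_pos; [lra | apply pow2_ge_0]).
    assert (Hkk : 8 * (Y * k ^ 2) * s ^ 2 <= 2 * s ^ 2).
    { apply Rmult_le_compat_r; [apply pow2_ge_0|].
      replace (Y * k ^ 2) with (k * (1 - k)) by (rewrite <- HYk; ring).
      assert (Hquarter := pow2_ge_0 (2 * k - 1)). lra. }
    lra. }
  assert (Ha : (1 + Y) * a ^ 2 <= (9 - 4 * c * k + c * (1 + 2 * Y)) * a ^ 2).
  { apply Rmult_le_compat_r; [apply pow2_ge_0|].
    assert (c * k <= 1) by nra. assert (0 <= (2 * c - 1) * Y) by (apply Rmult_le_pos; lra). lra. }
  assert (Hb : (1 + 3 * Y) * b ^ 2 <= (9 * Y + 4 * c * k - c * (1 + 2 * Y)) * b ^ 2).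
  { apply Rmult_le_compat_r; [apply pow2_ge_0|].
    assert (c * (1 - Y) <= c * k) by (apply Rmult_le_compat_l; lra).
    assert (0 <= (1 - c) * Y) by (apply Rmult_le_pos; lra). lra. }
  assert (Hs : - s ^ 2 <= (4 * c * k - c) * s ^ 2).
  { replace (- s ^ 2) with (-1 * s ^ 2) by ring.
    apply Rmult_le_compat_r; [apply pow2_ge_0 | nra]. }
  lra.
Qed.

Lemma morawetz_source_ge t r : 0 < t <= T0 -> 2 * (tip_rate * t) <= 1 -> 0 < r <= t ->
  2 * density t r - 8 * tip_rate <= morawetz_source t r.
Proof.
  intros Ht HKt Hr. assert (Hrate := tip_rate_pos). assert (HF := F_ge1 t r).
  assert (Hcos := one_minus_cos_le t r Ht Hr). assert (Hcos1 := COS_bound (u t r)).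
  assert (Hs := r_slope_sqr_le t r Ht Hr).
  assert (Hrate_r : tip_rate * r <= tip_rate * t) by (apply Rmult_le_compat_l; lra).
  assert (Halg := morawetz_source_algebra (F t r - 1) (/ F t r) (slope t r) (cos (u t r))
    (ut t r) (ur t r) ltac:(lra) ltac:(field; lra) ltac:(lra)).
  apply (Rmult_le_compat_l r) in Halg; [|lra].
  apply Rle_trans with (2 * density t r - 4 * (r * slope t r ^ 2)); [lra|].
  replace (2 * density t r - 4 * (r * slope t r ^ 2)) with
    (r * ((1 + (F t r - 1)) * (ut t r ^ 2 + ur t r ^ 2) - 3 * slope t r ^ 2))
    by (unfold density; field).
  apply (Rle_trans _ _ _ Halg). right. unfold morawetz_source.
  replace (alpha ^ 2 * slope t r ^ 2) with (F t r - 1) by (unfold F; ring). field. lra.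
Qed.

Lemma r2_F_slope_mult_le t r z b : 0 < t <= T0 -> 0 < r <= t -> 0 < b ->
  Rabs (r ^ 2 * ((F t r - 4) * slope t r * z))
    <= 3 * (b * (r * F t r * z ^ 2 / 2) + sinF_bound * r / (2 * b)).
Proof.
  intros Ht Hr Hb. assert (HF := F_ge1 t r).
  assert (Hsin := r2_F_slope_sqr_le t r Ht Hr). assert (Hyoung := young b z (r * slope t r) Hb).
  replace (r ^ 2 * ((F t r - 4) * slope t r * z))
    with (r * ((F t r - 4) * (z * (r * slope t r)))) by ring.
  rewrite !(Rabs_mult r), (Rabs_mult (F t r - 4)), (Rabs_pos_eq r) by lra.
  assert (HF3 : Rabs (F t r - 4) <= 3 * F t r) by (apply Rabs_le; lra).
  apply Rle_trans with (r * (3 * F t r * (b * z ^ 2 / 2 + (r * slope t r) ^ 2 / (2 * b)))).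
  - apply Rmult_le_compat_l; [lra|].
    apply Rmult_le_compat; [apply Rabs_pos | apply Rabs_pos | exact HF3 | exact Hyoung].
  - assert (Hsin_r : r * (r ^ 2 * F t r * slope t r ^ 2) * / (2 * b) <= sinF_bound * r * / (2 * b)).
    { apply Rmult_le_compat_r; [apply Rlt_le, Rinv_0_lt_compat; lra|].
      rewrite Rmult_comm. apply Rmult_le_compat_r; lra. }
    replace (r * (3 * F t r * (b * z ^ 2 / 2 + (r * slope t r) ^ 2 / (2 * b)))) with
      (3 * (b * (r * F t r * z ^ 2 / 2) + r * (r ^ 2 * F t r * slope t r ^ 2) * / (2 * b)))
      by (field; lra).
    unfold Rdiv at 3. lra.
Qed.

Lemma Rabs_flux_le t r : 0 <= r -> Rabs (flux t r) <= density t r.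
Proof.
  intros Hr. assert (Hp := density_plus_flux t r). assert (Hm := density_minus_flux t r).
  assert (HP := inflow_ge0 t r Hr). assert (HQ := outflow_ge0 t r Hr).
  assert (0 <= r * slope t r ^ 2) by (apply Rmult_le_pos; [exact Hr | apply pow2_ge_0]).
  apply Rabs_le. lra.
Qed.

Lemma Rabs_morawetz_le t r b : 0 < t <= T0 -> 0 < r <= t -> 0 < b ->
  Rabs (morawetz t r) <= (9 * r + 3 * b) * density t r + 3 * (sinF_bound * r / (2 * b)).
Proof.
  intros Ht Hr Hb. assert (Hslope := r2_F_slope_mult_le t r (ut t r) b Ht Hr Hb).
  assert (Hflux := Rabs_flux_le t r ltac:(lra)).
  apply (Rmult_le_compat_l (9 * r)) in Hflux; [|lra].
  assert (Hut : b * (r * F t r * ut t r ^ 2 / 2) <= b * density t r).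
  { apply Rmult_le_compat_l; [lra|]. unfold density.
    assert (HF := F_ge1 t r).
    assert (0 <= r * (F t r * ur t r ^ 2))
      by (apply Rmult_le_pos; [lra | apply Rmult_le_pos; [lra | apply pow2_ge_0]]).
    assert (0 <= r * slope t r ^ 2) by (apply Rmult_le_pos; [lra | apply pow2_ge_0]). lra. }
  replace (morawetz t r) with (r ^ 2 * ((F t r - 4) * slope t r * ut t r) - 9 * r * flux t r)
    by (unfold morawetz, flux; ring).
  apply Rle_trans with (1 := Rabs_triang _ _). rewrite Rabs_Ropp, (Rabs_mult (9 * r)).
  rewrite (Rabs_pos_eq (9 * r)) by lra. lra.
Qed.

Lemma morawetz_ex_RInt t a b : 0 < t <= T0 -> 0 <= a -> a <= b -> b <= t ->
  ex_RInt (morawetz t) a b.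
Proof.
  intros Ht Ha Hab Hb. destruct morawetz_balance as (At & Ar & _ & _ & HA & _).
  apply (C1_on_slice_ex_RInt domain _ At Ar); [exact HA | exact Hab|].
  intros r Hr. apply cone_in_domain; lra.
Qed.

Lemma morawetz_piece_le t a b c k : 0 < t <= T0 -> 0 <= a -> a <= b <= t -> 0 < c ->
  9 * b + 3 * c <= k ->
  Rabs (RInt (morawetz t) a b)
    <= k * RInt (density t) a b + 3 * (sinF_bound * b / (2 * c)) * (b - a).
Proof.
  intros Ht Ha Hb Hc Hk. assert (Hbound := sinF_bound_pos).
  apply Rabs_RInt_le_affine; [lra | apply morawetz_ex_RInt; lra | apply density_ex_RInt; lra|].
  intros r Hr. apply (Rle_trans _ _ _ (Rabs_morawetz_le t r c Ht ltac:(lra) Hc)).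
  apply Rplus_le_compat.
  - apply Rmult_le_compat_r; [apply density_ge0|]; lra.
  - apply Rmult_le_compat_l; [lra|].
    apply Rmult_le_compat_r; [apply Rlt_le, Rinv_0_lt_compat; lra|].
    apply Rmult_le_compat_l; lra.
Qed.

Lemma morawetz_integral_le lam t : 0 < lam < 1 -> 0 < t <= T0 ->
  Rabs (RInt (morawetz t) 0 t) <=
    t * (12 * lam * energy T0 + 12 / lam * RInt (density t) (lam * t) t + 3 * sinF_bound * lam).
Proof.
  intros Hlam Ht. assert (Hbound := sinF_bound_pos). assert (Hlt : 0 < lam * t < t) by nra.
  assert (Htl : t <= t / lam).
  { replace t with (lam * (t / lam)) at 1 by (field; lra).
    assert (0 < t / lam) by (apply Rdiv_lt_0_compat; lra). nra. }
  rewrite (RInt_split (morawetz t) 0 (lam * t) t) by (try apply morawetz_ex_RInt; lra).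
  assert (Hin := morawetz_piece_le t 0 (lam * t) (lam * t) (12 * (lam * t)) Ht
    ltac:(lra) ltac:(lra) ltac:(lra) ltac:(lra)).
  assert (Hout := morawetz_piece_le t (lam * t) t (t / lam) (12 * (t / lam)) Ht
    ltac:(lra) ltac:(lra) ltac:(lra) ltac:(lra)).
  replace (3 * (sinF_bound * (lam * t) / (2 * (lam * t)))) with (3 / 2 * sinF_bound) in Hin
    by (field; lra).
  replace (3 * (sinF_bound * t / (2 * (t / lam)))) with (3 / 2 * sinF_bound * lam) in Hout
    by (field; lra).
  assert (HE := local_energy_le t 0 (lam * t) Ht ltac:(lra) ltac:(lra) ltac:(lra)).
  apply (Rmult_le_compat_l (12 * (lam * t))) in HE; [|lra].
  assert (Hout_len : 3 / 2 * sinF_bound * lam * (t - lam * t) <= 3 / 2 * sinF_bound * lam * t).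
  { apply Rmult_le_compat_l; [|lra]. apply Rmult_le_pos; lra. }
  replace (t * (12 * lam * energy T0 + 12 / lam * RInt (density t) (lam * t) t
      + 3 * sinF_bound * lam))
    with (12 * (lam * t) * energy T0 + 12 * (t / lam) * RInt (density t) (lam * t) t
      + 3 * sinF_bound * lam * t) by (field; lra).
  apply (Rle_trans _ _ _ (Rabs_triang _ _)). lra.
Qed.

Lemma morawetz_cone_ge t lam : 0 < t <= T0 -> 0 < lam ->
  - ((9 + 3 / lam) * (t * cone_flux t)) - 2 * lam * sinF_bound <= morawetz t t + morawetz_flux t t.
Proof.
  intros Ht Hlam. assert (Hbound := sinF_bound_pos).
  assert (Hflux := inflow_le_cone_flux t ltac:(lra)).
  assert (Hslope := r2_F_slope_mult_le t t (ut t t + ur t t) (t / lam) Ht ltac:(lra)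
    ltac:(apply Rdiv_lt_0_compat; lra)).
  fold (inflow t t) in Hslope.
  replace (sinF_bound * t / (2 * (t / lam))) with (lam * sinF_bound / 2) in Hslope by (field; lra).
  replace (t / lam * inflow t t) with (/ lam * (t * inflow t t)) in Hslope by (field; lra).
  replace (morawetz t t + morawetz_flux t t) with
    (t ^ 2 * ((F t t - 4) * slope t t * (ut t t + ur t t)) - 9 * (t * inflow t t)
     + 9 * (t * slope t t) ^ 2 / 2)
    by (unfold morawetz, morawetz_flux, inflow; field).
  apply Rabs_le_between in Hslope.
  assert (Hweighted : (9 + 3 / lam) * (t * inflow t t) <= (9 + 3 / lam) * (t * cone_flux t)).
  { apply Rmult_le_compat_l; [|apply Rmult_le_compat_l; lra].
    assert (0 < 3 / lam) by (apply Rdiv_lt_0_compat; lra). lra. }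
  assert (Hsin := pow2_ge_0 (t * slope t t)).
  assert (0 < lam * sinF_bound) by (apply Rmult_lt_0_compat; lra).
  unfold Rdiv at 2 in Hweighted. lra.
Qed.

Lemma morawetz_growth lam T x : 0 < lam -> 0 < T -> T <= x <= 2 * T -> 2 * T <= T0 ->
  4 * (tip_rate * T) <= 1 ->
  exists d, is_derive (fun t => RInt (morawetz t) 0 t) x d /\
    2 * energy T - (9 + 3 / lam) * (2 * T * cone_flux x) - 2 * lam * sinF_bound
      - 16 * (tip_rate * T) <= d.
Proof.
  intros Hlam HT Hx HT0 HrateT. assert (Hrate := tip_rate_pos).
  destruct (balance_cone_slice _ _ _ x morawetz_balance) as [Hex Hder]; [lra|].
  eexists. split; [exact Hder|].
  assert (Hrate_x : tip_rate * x <= 2 * (tip_rate * T)).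
  { replace (2 * (tip_rate * T)) with (tip_rate * (2 * T)) by ring. apply Rmult_le_compat_l; lra. }
  assert (Hsource : 2 * RInt (density x) 0 x + - (8 * tip_rate) * (x - 0)
    <= RInt (morawetz_source x) 0 x).
  { apply RInt_ge_affine; [lra | exact Hex | apply density_ex_RInt; lra|].
    intros r Hr. apply morawetz_source_ge; lra. }
  fold (energy x) in Hsource.
  assert (Hcone := morawetz_cone_ge x lam ltac:(lra) Hlam).
  assert (Hmono := energy_mono T x HT ltac:(lra) ltac:(lra)).
  assert (Hflux : x * cone_flux x <= 2 * T * cone_flux x).
  { apply Rmult_le_compat_r; [|lra].
    apply Rle_trans with (inflow x x); [apply inflow_ge0 | apply inflow_le_cone_flux]; lra. }
  assert (Hlam3 : 0 < 3 / lam) by (apply Rdiv_lt_0_compat; lra).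
  apply (Rmult_le_compat_l (9 + 3 / lam)) in Hflux; [|lra].
  replace (morawetz_flux x 0) with 0 by (unfold morawetz_flux; ring). lra.
Qed.

Lemma energy_le_morawetz lam T :
  0 < lam -> 0 < T -> 2 * T <= T0 -> 4 * (tip_rate * T) <= 1 ->
  2 * energy T * T <= RInt (morawetz (2 * T)) 0 (2 * T) - RInt (morawetz T) 0 T
    + (9 + 3 / lam) * (2 * T * (energy (2 * T) - energy T))
    + (2 * lam * sinF_bound + 16 * (tip_rate * T)) * T.
Proof.
  intros Hlam HT HT0 HrateT. set (k := (9 + 3 / lam) * (2 * T)).
  set (m := 2 * lam * sinF_bound + 16 * (tip_rate * T) - 2 * energy T).
  assert (Hmono : RInt (morawetz T) 0 T + k * energy T + m * T
    <= RInt (morawetz (2 * T)) 0 (2 * T) + k * energy (2 * T) + m * (2 * T)).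
  { apply (nondecreasing_of_derive (fun x => RInt (morawetz x) 0 x + k * energy x + m * x)); [lra|].
    intros x Hx. destruct (morawetz_growth lam T x Hlam HT Hx HT0 HrateT) as [d [Hd Hdge]].
    exists (d + k * cone_flux x + m). split; [|unfold k, m; lra].
    apply (@is_derive_plus R_AbsRing R_NormedModule);
      [apply (@is_derive_plus R_AbsRing R_NormedModule); [exact Hd|] |].
    - apply is_derive_scal, energy_derive. lra.
    - auto_derive; [auto | ring]. }
  unfold m, k in Hmono. lra.
Qed.

Lemma energy_eventually_le lam : 0 < lam < 1 ->
  at_right 0 (fun T => energy T <= lam * (18 * energy T0 + 6 * sinF_bound + 32)).
Proof.
  intros Hlam. assert (Hrate := tip_rate_pos). assert (Hbound := sinF_bound_pos).
  assert (Hlam2 : 0 < lam ^ 2) by (apply pow_lt; lra).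
  destruct (energy_oscillation (lam ^ 2) Hlam2) as [d [Hd Hosc]].
  assert (Hd2 : 0 < d / 2) by lra.
  assert (Hsmall : 0 < lam / (4 * tip_rate)) by (apply Rdiv_lt_0_compat; lra).
  assert (Hext := exterior_decay lam (lam ^ 2) Hlam Hlam2).
  apply (filter_imp _ _) with (2 := filter_and _ _
    (filter_and _ _ Hext (at_right_0_scale 2 _ Rlt_0_2 Hext))
    (filter_and _ _ (at_right_0_interval _ Hd2) (at_right_0_interval _ Hsmall))).
  intros T [[HextT Hext2T] [HTd HTrate]].
  assert (HrateT : 4 * (tip_rate * T) <= lam).
  { replace lam with (4 * (tip_rate * (lam / (4 * tip_rate)))) by (field; lra).
    apply Rmult_le_compat_l; [lra|]. apply Rmult_le_compat_l; lra. }
  assert (Hmorawetz := energy_le_morawetz lam T ltac:(lra) ltac:(lra) ltac:(lra) ltac:(lra)).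
  assert (HE := Hosc T (2 * T) ltac:(lra) ltac:(lra) ltac:(lra)).
  set (B := lam * (12 * energy T0 + 12 + 3 * sinF_bound)).
  assert (Hintegral : forall t, 0 < t <= T0 ->
    RInt (density t) (lam * t) t <= lam ^ 2 -> Rabs (RInt (morawetz t) 0 t) <= t * B).
  { intros t Ht Hextt. apply (Rle_trans _ _ _ (morawetz_integral_le lam t Hlam Ht)).
    apply Rmult_le_compat_l; [lra|].
    apply (Rmult_le_compat_l (12 / lam)) in Hextt; [|apply Rlt_le, Rdiv_lt_0_compat; lra].
    replace (12 / lam * lam ^ 2) with (12 * lam) in Hextt by (field; lra). unfold B. lra. }
  assert (HT := Hintegral T ltac:(lra) HextT).
  assert (Htwo_T := Hintegral (2 * T) ltac:(lra) Hext2T).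
  apply Rabs_le_between in HT. apply Rabs_le_between in Htwo_T.
  assert (Hgain : (9 + 3 / lam) * (2 * T * (energy (2 * T) - energy T)) <= 24 * lam * T).
  { apply Rle_trans with ((9 + 3 / lam) * (2 * T * lam ^ 2)).
    - apply Rmult_le_compat_l; [|apply Rmult_le_compat_l; lra].
      assert (0 < 3 / lam) by (apply Rdiv_lt_0_compat; lra). lra.
    - replace ((9 + 3 / lam) * (2 * T * lam ^ 2)) with ((18 * lam + 6) * (lam * T))
        by (field; lra).
      replace (24 * lam * T) with (24 * (lam * T)) by ring.
      apply Rmult_le_compat_r; [apply Rmult_le_pos|]; lra. }
  apply (Rmult_le_compat_r T) in HrateT; [|lra].
  assert (0 <= lam * sinF_bound * T) by (repeat apply Rmult_le_pos; lra).
  apply (Rmult_le_reg_r (2 * T)); [lra|]. unfold B in *. lra.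
Qed.

Lemma energy_vanishes eps : 0 < eps -> at_right 0 (fun T => energy T < eps).
Proof.
  intros Heps. assert (HE := energy_ge0 T0 ltac:(lra)). assert (Hbound := sinF_bound_pos).
  set (G := 18 * energy T0 + 6 * sinF_bound + 32). assert (HG : 0 < G) by (unfold G; lra).
  set (lam := Rmin (/ 2) (eps / (2 * G))).
  assert (Hlam_pos : 0 < lam) by (apply Rmin_pos; [lra | apply Rdiv_lt_0_compat; lra]).
  assert (Hlam_half : lam <= / 2) by apply Rmin_l.
  assert (HlamG : lam * G <= eps / 2).
  { replace (eps / 2) with (eps / (2 * G) * G) by (field; lra).
    apply Rmult_le_compat_r; [lra | apply Rmin_r]. }
  apply (filter_imp _ _) with (2 := energy_eventually_le lam ltac:(lra)).
  intros T HT. fold G in HT. lra.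
Qed.

End Skyrme.

Theorem theorem1 (alpha T0 : R) (u : R -> R -> R)
  (D : nat -> nat -> R -> R -> R) :
  0 < alpha -> 0 < T0 ->
  smooth_on_Omega T0 u D ->
  (forall t r, 0 < t <= T0 -> 0 < r <= t -> skyrme_eq alpha D t r) ->
  (forall t, 0 < t <= T0 -> u t 0 = 0) ->
  exists E : R -> R,
    (forall T, 0 < T <= T0 ->
       exists pr : Riemann_integrable (energy_density alpha D T) 0 T,
         RiemannInt pr = E T) /\
    (forall eps, 0 < eps -> exists delta, 0 < delta /\
       forall T, 0 < T < delta -> T <= T0 -> Rabs (E T) < eps).
Proof.
  intros Halpha HT0 (U & HU & HOmega & Hsmooth & HDu) Hpde Haxis.
  assert (HaxisD : forall t, 0 < t <= T0 -> D 0%nat 0%nat t 0 = 0).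
  { intros t Ht. rewrite HDu by (apply HOmega; unfold Omega; lra). apply Haxis, Ht. }
  exists (energy alpha D). split.
  - intros T HT.
    assert (Hdensity : is_RInt (energy_density alpha D T) 0 T (energy alpha D T)).
    { apply (is_RInt_ext (density alpha D T)).
      - intros r Hr. rewrite Rmin_left, Rmax_right in Hr by lra.
        symmetry. apply (density_eq alpha T0 D U); auto; lra.
      - apply (@RInt_correct R_CompleteNormedModule).
        apply (density_ex_RInt alpha T0 D U); auto; lra. }
    exists (ex_RInt_Reals_0 _ _ _ (ex_intro _ _ Hdensity)).
    rewrite <- RInt_Reals. apply is_RInt_unique, Hdensity.
  - intros eps Heps.
    destruct (at_right_0_exists _ (energy_vanishes alpha T0 D U Halpha HT0 HU HOmega Hsmooth
      Hpde HaxisD eps Heps)) as [delta [Hdelta Hsmall]].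
    exists delta. split; [exact Hdelta|]. intros T HT HTT0.
    rewrite Rabs_pos_eq; [apply Hsmall, HT|].
    apply (energy_ge0 alpha T0 D U); auto; lra.
Qed.
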